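(* Let $n\ge1$, let $\phi,\chi\in(L1)_n$ be pasting instructions with $\mathrm{ar}(\phi)=\mathrm{ar}(\chi)=\boldsymbol k$ (not necessarily parallel), let $(X,\xi)$ be a weak $\omega$-category, let $\boldsymbol u,\boldsymbol v\in(TX)_n$ be a parallel pair of pasting diagrams of shape $\boldsymbol k$, and let $w\colon\xi(\phi,\boldsymbol u)\to\xi(\phi,\boldsymbol v)$ be an $(n+1)$-cell of $X$. Suppose further that we are given: - an $(n+1)$-dimensional pasting scheme $\dot{\boldsymbol k}\colon\boldsymbol k\to\boldsymbol k$ (an $(n+1)$-cell of $T1$); - $(n+1)$-dimensional pasting instructions $\dot\phi\colon\phi\to\phi$ and $\dot\chi\colon\chi\to\chi$ of arity $\dot{\boldsymbol k}$ ($(n+1)$-cells of $L1$); and - an $(n+1)$-dimensional pasting diagram $\boldsymbol w\colon\boldsymbol u\to\boldsymbol v$ of shape $\dot{\boldsymbol k}$ in $X$ (an $(n+1)$-cell of $TX$) such that $w=\xi(\dot\phi,\boldsymbol w)$. Then there exists an invertible $(n+2)$-cell in $X$ from the $\phi$-to-$\chi$ padding $w_{n+1}$ of $w$ (with respect to $(\boldsymbol u,\boldsymbol v)$) to $\xi(\dot\chi,\boldsymbol w)$.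
   Context: **Globular sets.** A globular set $X$ consists of sets $X_n$ ($n\ge 0$; elements are called $n$-cells) and maps $s_n,t_n\colon X_{n+1}\to X_n$ with $s_ns_{n+1}=s_nt_{n+1}$ and $t_ns_{n+1}=t_nt_{n+1}$; for $m<n$, $s_m,t_m\colon X_n\to X_m$ also denote the iterated source and target maps. Globular maps commute with sources and targets; $\mathbf{GSet}$ is the resulting category. Two $n$-cells are parallel if $n=0$ or they have the same $(n-1)$-source and the same $(n-1)$-target. For an $n$-cell $u$ with $n\ge1$, $u\colon x\to y$ means $s_{n-1}(u)=x$, $t_{n-1}(u)=y$. **Weak $\omega$-categories (Batanin–Leinster).** Let $T=(T,\eta^T,\mu^T)$ be the free strict $\omega$-category monad on $\mathbf{GSet}$, $1$ the terminal globular set, and $!$ the unique maps to $1$. A cartesian monad over $T$ with contraction is a monad $P$ on $\mathbf{GSet}$ with a monad map $\mathrm{ar}\colon P\to T$ all of whose naturality squares are pullbacks, together with a function $\kappa$ assigning to each $n\ge 1$, each parallel pair $(\phi,\phi')$ of $(n-1)$-cells of $P1$ and each $n$-cell $k\colon \mathrm{ar}_1(\phi)\to\mathrm{ar}_1(\phi')$ of $T1$ an $n$-cell $\kappa(\langle\phi,\phi'\rangle,k)\colon\phi\to\phi'$ of $P1$ sent to $k$ by $\mathrm{ar}_1$. Morphisms are monad maps commuting with $\mathrm{ar}$ and preserving $\kappa$. Let $L=(L,\eta^L,\mu^L)$ be the initial such object, and write $\mathrm{ar}$ for $\mathrm{ar}_1\colon L1\to T1$. A weak $\omega$-category is an Eilenberg–Moore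 algebra $(X,\xi\colon LX\to X)$ of $L$. Since $LX\cong L1\times_{T1}TX$, an $n$-cell of $LX$ is a pair $(\phi,\boldsymbol u)$ with $\phi\in(L1)_n$, $\boldsymbol u\in (TX)_n$, $\mathrm{ar}(\phi)=T!(\boldsymbol u)$. An $n$-cell of $T1$ is called a pasting scheme of dimension $n$; an $n$-cell $\phi$ of $L1$ is a pasting instruction of dimension $n$ and arity $\mathrm{ar}(\phi)$; an $n$-cell $\boldsymbol u$ of $TX$ is a pasting diagram of dimension $n$ in $X$ and of shape $T!(\boldsymbol u)\in(T1)_n$. **Identities and composition.** Define $\mathrm{sp}\colon T1\to L1$ (a section of $\mathrm{ar}$) inductively: $\mathrm{sp}(\eta^T_1(\ast_n))=\eta^L_1(\ast_n)$, where $\ast_n$ is the unique $n$-cell of $1$; any other cell $k\in(T1)_n$ has $n\ge1$ and the form $k\colon k'\to k'$, and $\mathrm{sp}(k)=\kappa(\langle \mathrm{sp}(k'),\mathrm{sp}(k')\rangle,k)$. Write $[x]=\eta^T_X(x)$. In a weak $\omega$-category $(X,\xi)$: for an $(n-1)$-cell $x$, $\mathrm{id}^X_n(x)=\xi(\mathrm{sp}(T!(\boldsymbol u)),\boldsymbol u)$ with $\boldsymbol u$ the identity $n$-cell on $[x]$ in the strict $\omega$-category $TX$; for cells $u,v$ of dimensions $m_1,m_2>k$ with $t_k(u)=s_k(v)$, $u\ast^X_k v=\xi(\mathrm{sp}(T!(\boldsymbol u)),\boldsymbol u)$ with $\boldsymbol u=[u]\ast_k[v]$ the composite in $TX$ (diagrammatic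 order), regarded as a cell of dimension $\max\{m_1,m_2\}$. In particular this applies to the free weak $\omega$-category $(L1,\mu^L_1)$, giving $\ast^{L1}_k$. In the strict $\omega$-categories $T1$ and $TX$, $\mathrm{id}^{T1}_i$ and $\mathrm{id}^{TX}_i$ denote the identity $i$-cells on $(i-1)$-cells. **Invertible cells.** Invertibility is defined coinductively (as the greatest class with this property): an $n$-cell $u\colon x\to y$ ($n\ge1$) of $X$ is invertible iff there are an $n$-cell $\check u\colon y\to x$ and invertible $(n+1)$-cells $u\ast_{n-1}\check u\to\mathrm{id}_n(x)$ and $\check u\ast_{n-1}u\to\mathrm{id}_n(y)$. **Padding.** Let $n\ge1$ and $\phi,\chi\in(L1)_n$ with $\mathrm{ar}(\phi)=\mathrm{ar}(\chi)=\boldsymbol k$. Put $\phi_0=\phi$ and, for $1\le i\le n$, define inductively - $\lambda_i=\kappa\bigl(\langle s_{i-1}(\chi),s_{i-1}(\phi_{i-1})\rangle,\ \mathrm{id}^{T1}_i(s_{i-1}(\boldsymbol k))\bigr)\in(L1)_i$, - $\rho_i=\kappa\bigl(\langle t_{i-1}(\phi_{i-1}),t_{i-1}(\chi)\rangle,\ \mathrm{id}^{T1}_i(t_{i-1}(\boldsymbol k))\bigr)\in(L1)_i$, - $\phi_i=\lambda_i\ast^{L1}_{i-1}(\phi_{i-1}\ast^{L1}_{i-1}\rho_i)\in(L1)_n$. (These are well defined: $\mathrm{ar}(\phi_i)=\boldsymbol k$ and $\phi_i$ has the same $(i-1)$-source and $(i-1)$-target as $\chi$; so $\phi_n$ is parallel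 to $\chi$.) Also put $\lambda_{n+1}=\kappa(\langle\chi,\phi_n\rangle,\mathrm{id}^{T1}_{n+1}(\boldsymbol k))$ and $\rho_{n+1}=\kappa(\langle\phi_n,\chi\rangle,\mathrm{id}^{T1}_{n+1}(\boldsymbol k))$ in $(L1)_{n+1}$. Given a weak $\omega$-category $(X,\xi)$, parallel $\boldsymbol u,\boldsymbol v\in(TX)_n$ of shape $\boldsymbol k$, and an $(n+1)$-cell $w\colon\xi(\phi,\boldsymbol u)\to\xi(\phi,\boldsymbol v)$, put $w_0=w$ and for $1\le i\le n+1$ - $\ell_i=\xi\bigl(\lambda_i,\mathrm{id}^{TX}_i(s_{i-1}(\boldsymbol u))\bigr)\in X_i$, - $r_i=\xi\bigl(\rho_i,\mathrm{id}^{TX}_i(t_{i-1}(\boldsymbol v))\bigr)\in X_i$, - $w_i=\ell_i\ast^X_{i-1}(w_{i-1}\ast^X_{i-1}r_i)\in X_{n+1}$, where for $i=n+1$ the expressions $s_n(\boldsymbol u)$, $t_n(\boldsymbol v)$ are read as $\boldsymbol u$, $\boldsymbol v$. The resulting $(n+1)$-cell $w_{n+1}\colon\xi(\chi,\boldsymbol u)\to\xi(\chi,\boldsymbol v)$ is the $\phi$-to-$\chi$ padding of $w$ with respect to $(\boldsymbol u,\boldsymbol v)$. *)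

(* Defs.v *)
From mathcomp Require Import all_boot.
From mathcomp Require Import boolp.

Set Implicit Arguments.
Unset Strict Implicit.
Unset Printing Implicit Defensive.

Record gset := GSet {
  cell :> nat -> Type;
  src : forall n, cell n.+1 -> cell n;
  tgt : forall n, cell n.+1 -> cell n;
  src_src : forall n (x : cell n.+2), src (src x) = src (tgt x);
  tgt_src : forall n (x : cell n.+2), tgt (src x) = tgt (tgt x) }.

Record gmap (X Y : gset) := GMap {
  gfun :> forall n, X n -> Y n;
  gmap_src : forall n (x : X n.+1), gfun (src x) = src (gfun x);
  gmap_tgt : forall n (x : X n.+1), gfun (tgt x) = tgt (gfun x) }.

Definition geq (X Y : gset) (f g : gmap X Y) : Prop :=
  forall n (x : X n), f n x = g n x.

Definition gid (X : gset) : gmap X X :=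
  @GMap X X (fun _ x => x) (fun _ _ => erefl) (fun _ _ => erefl).

Definition gcomp (X Y Z : gset) (g : gmap Y Z) (f : gmap X Y) : gmap X Z.
Proof.
refine (@GMap X Z (fun n x => g n (f n x)) _ _).
- by move=> n x; rewrite !gmap_src.
- by move=> n x; rewrite !gmap_tgt.
Defined.

Definition gone : gset :=
  @GSet (fun _ => unit) (fun _ _ => tt) (fun _ _ => tt)
        (fun _ _ => erefl) (fun _ _ => erefl).

Definition gbang (X : gset) : gmap X gone :=
  @GMap X gone (fun _ _ => tt) (fun _ _ => erefl) (fun _ _ => erefl).

Definition parallel (X : gset) (n : nat) : X n -> X n -> Prop :=
  match n with
  | 0 => fun _ _ => True
  | m.+1 => fun x y => src x = src y /\ tgt x = tgt y
  end.

Definition cast (X : nat -> Type) (m n : nat) (e : m = n) (x : X m) : X n :=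
  eq_rect m X x n e.

Fixpoint iter_src (X : gset) (d m : nat) : X (d + m) -> X m :=
  match d with
  | 0 => fun x => x
  | d'.+1 => fun x : X (d' + m).+1 => iter_src (src x)
  end.

Fixpoint iter_tgt (X : gset) (d m : nat) : X (d + m) -> X m :=
  match d with
  | 0 => fun x => x
  | d'.+1 => fun x : X (d' + m).+1 => iter_tgt (tgt x)
  end.

(* Iterated source and target, allowing m = n, where they are identities.     *)
Definition srcs (X : gset) (m n : nat) (h : m <= n) (x : X n) : X m :=
  iter_src (cast (esym (subnK h)) x).

Definition tgts (X : gset) (m n : nat) (h : m <= n) (x : X n) : X m :=
  iter_tgt (cast (esym (subnK h)) x).

Definition is_pullback (A B C D : gset) (p : gmap A B) (q : gmap A C)
    (f : gmap B D) (g : gmap C D) : Prop :=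
  geq (gcomp f p) (gcomp g q) /\
  forall (Z : gset) (z1 : gmap Z B) (z2 : gmap Z C),
    geq (gcomp f z1) (gcomp g z2) ->
    exists m : gmap Z A,
      [/\ geq (gcomp p m) z1, geq (gcomp q m) z2 &
          forall m' : gmap Z A,
            geq (gcomp p m') z1 -> geq (gcomp q m') z2 -> geq m' m].

Record gmonad := GMonad {
  mobj :> gset -> gset;
  mmap : forall X Y : gset, gmap X Y -> gmap (mobj X) (mobj Y);
  meta : forall X : gset, gmap X (mobj X);
  mmu : forall X : gset, gmap (mobj (mobj X)) (mobj X);
  mmap_id : forall X, geq (mmap (gid X)) (gid (mobj X));
  mmap_comp : forall X Y Z (g : gmap Y Z) (f : gmap X Y),
    geq (mmap (gcomp g f)) (gcomp (mmap g) (mmap f));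
  meta_nat : forall X Y (f : gmap X Y),
    geq (gcomp (mmap f) (meta X)) (gcomp (meta Y) f);
  mmu_nat : forall X Y (f : gmap X Y),
    geq (gcomp (mmap f) (mmu X)) (gcomp (mmu Y) (mmap (mmap f)));
  mmu_eta : forall X, geq (gcomp (mmu X) (meta (mobj X))) (gid (mobj X));
  mmu_map_eta : forall X, geq (gcomp (mmu X) (mmap (meta X))) (gid (mobj X));
  mmu_mu : forall X,
    geq (gcomp (mmu X) (mmu (mobj X))) (gcomp (mmu X) (mmap (mmu X))) }.

Record monad_map (P Q : gmonad) := MonadMap {
  mm_fun :> forall X : gset, gmap (P X) (Q X);
  mm_nat : forall X Y (f : gmap X Y),
    geq (gcomp (mm_fun Y) (mmap P f)) (gcomp (mmap Q f) (mm_fun X));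
  mm_eta : forall X, geq (gcomp (mm_fun X) (meta P X)) (meta Q X);
  mm_mu : forall X,
    geq (gcomp (mm_fun X) (mmu P X))
        (gcomp (mmu Q X) (gcomp (mmap Q (mm_fun X)) (mm_fun (P X)))) }.

Record algebra (P : gmonad) := Algebra {
  acar :> gset;
  astr : gmap (P acar) acar;
  astr_eta : geq (gcomp astr (meta P acar)) (gid acar);
  astr_mu : geq (gcomp astr (mmu P acar)) (gcomp astr (mmap P astr)) }.

Definition free_algebra (P : gmonad) (X : gset) : algebra P :=
  @Algebra P (P X) (mmu P X) (@mmu_eta P X) (@mmu_mu P X).

Section IteratedIdentity.
Variables (X : gset) (i : forall n, X n -> X n.+1).

Fixpoint iter_id (d m : nat) : X m -> X (d + m) :=
  match d with
  | 0 => fun x => x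
  | d'.+1 => fun x => i (iter_id d' x)
  end.

Definition ids (m n : nat) (h : m <= n) (x : X m) : X n :=
  cast (subnK h) (iter_id (n - m) x).

End IteratedIdentity.

(* [ocomp e] is the composite x *_k y of n-cells, in diagrammatic order. The  *)
(* laws quantify over all proofs of composability; those for composites of    *)
(* composites follow from globularity.                                        *)
Record omega_cat := OmegaCat {
  ocar :> gset;
  oid : forall n, ocar n -> ocar n.+1;
  ocomp : forall k n (h : k < n) (x y : ocar n),
    tgts (ltnW h) x = srcs (ltnW h) y -> ocar n;
  src_oid : forall n (x : ocar n), src (oid x) = x;
  tgt_oid : forall n (x : ocar n), tgt (oid x) = x;
  src_ocomp_top : forall n (h : n < n.+1) (x y : ocar n.+1)
    (e : tgts (ltnW h) x = srcs (ltnW h) y), src (ocomp e) = src x;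
  tgt_ocomp_top : forall n (h : n < n.+1) (x y : ocar n.+1)
    (e : tgts (ltnW h) x = srcs (ltnW h) y), tgt (ocomp e) = tgt y;
  src_ocomp : forall k n (h : k < n.+1) (h' : k < n) (x y : ocar n.+1)
    (e : tgts (ltnW h) x = srcs (ltnW h) y)
    (e' : tgts (ltnW h') (src x) = srcs (ltnW h') (src y)),
    src (ocomp e) = ocomp e';
  tgt_ocomp : forall k n (h : k < n.+1) (h' : k < n) (x y : ocar n.+1)
    (e : tgts (ltnW h) x = srcs (ltnW h) y)
    (e' : tgts (ltnW h') (tgt x) = srcs (ltnW h') (tgt y)),
    tgt (ocomp e) = ocomp e';
  ocompA : forall k n (h : k < n) (x y z : ocar n)
    (exy : tgts (ltnW h) x = srcs (ltnW h) y)
    (eyz : tgts (ltnW h) y = srcs (ltnW h) z)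
    (e1 : tgts (ltnW h) (ocomp exy) = srcs (ltnW h) z)
    (e2 : tgts (ltnW h) x = srcs (ltnW h) (ocomp eyz)),
    ocomp e1 = ocomp e2;
  ocomp_idl : forall k n (h : k < n) (x : ocar n)
    (e : tgts (ltnW h) (ids oid (ltnW h) (srcs (ltnW h) x)) =
         srcs (ltnW h) x),
    ocomp e = x;
  ocomp_idr : forall k n (h : k < n) (x : ocar n)
    (e : tgts (ltnW h) x =
         srcs (ltnW h) (ids oid (ltnW h) (tgts (ltnW h) x))),
    ocomp e = x;
  oid_ocomp : forall k n (h : k < n) (h' : k < n.+1) (x y : ocar n)
    (e : tgts (ltnW h) x = srcs (ltnW h) y)
    (e' : tgts (ltnW h') (oid x) = srcs (ltnW h') (oid y)),
    oid (ocomp e) = ocomp e';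
  ointerchange : forall j k n (hjk : j < k) (hk : k < n) (hj : j < n)
    (x y z w : ocar n)
    (exy : tgts (ltnW hk) x = srcs (ltnW hk) y)
    (ezw : tgts (ltnW hk) z = srcs (ltnW hk) w)
    (exz : tgts (ltnW hj) x = srcs (ltnW hj) z)
    (eyw : tgts (ltnW hj) y = srcs (ltnW hj) w)
    (e1 : tgts (ltnW hj) (ocomp exy) = srcs (ltnW hj) (ocomp ezw))
    (e2 : tgts (ltnW hk) (ocomp exz) = srcs (ltnW hk) (ocomp eyw)),
    ocomp e1 = ocomp e2 }.

(* The binary operation x *_k y as a total function; its value is immaterial  *)
(* when x and y are not composable.                                           *)
Definition scomp (C : omega_cat) k n (h : k < n) (x y : C n) : C n :=
  match pselect (tgts (ltnW h) x = srcs (ltnW h) y) with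
  | left e => ocomp e
  | right _ => x
  end.

Lemma ltn_maxl k m1 m2 n : maxn m1 m2 = n -> k < m1 -> k < n.
Proof. by move=> <- h; rewrite leq_max h. Qed.

Lemma leq_maxl_eq m1 m2 n : maxn m1 m2 = n -> m1 <= n.
Proof. by move=> <-; exact: leq_maxl. Qed.

Lemma leq_maxr_eq m1 m2 n : maxn m1 m2 = n -> m2 <= n.
Proof. by move=> <-; exact: leq_maxr. Qed.

(* x *_k y for cells of dimensions m1, m2 > k: the cell of lower dimension is *)
(* replaced by its iterated identity.                                         *)
Definition mcomp (C : omega_cat) k m1 m2 n (e : maxn m1 m2 = n)
    (h1 : k < m1) (h2 : k < m2) (x : C m1) (y : C m2) : C n :=
  scomp (ltn_maxl e h1) (ids (@oid C) (leq_maxl_eq e) x)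
                       (ids (@oid C) (leq_maxr_eq e) y).

Record ofunctor (C D : omega_cat) := OFunctor {
  ofun :> gmap C D;
  ofun_id : forall n (x : C n), ofun n.+1 (oid x) = oid (ofun n x);
  ofun_comp : forall k n (h : k < n) (x y : C n)
    (e : tgts (ltnW h) x = srcs (ltnW h) y)
    (e' : tgts (ltnW h) (ofun n x) = srcs (ltnW h) (ofun n y)),
    ofun n (ocomp e) = ocomp e' }.

(* A left adjoint to the forgetful functor from strict omega-categories to    *)
(* globular sets, presented by its universal arrows.                          *)
Record free_omega := FreeOmega {
  fobj :> gset -> omega_cat;
  feta : forall X : gset, gmap X (fobj X);
  flift : forall (X : gset) (C : omega_cat), gmap X C -> ofunctor (fobj X) C;
  flift_eta : forall (X : gset) (C : omega_cat) (f : gmap X C),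
    geq (gcomp (flift f) (feta X)) f;
  flift_uniq : forall (X : gset) (C : omega_cat) (f : gmap X C)
    (g : ofunctor (fobj X) C),
    geq (gcomp g (feta X)) f -> geq g (flift f) }.

Lemma gmap_cast (X Y : gset) (f : gmap X Y) m n (e : m = n) (x : X m) :
  f n (cast e x) = cast e (f m x).
Proof. by case: n / e. Qed.

Lemma gmap_srcs (X Y : gset) (f : gmap X Y) m n (h : m <= n) (x : X n) :
  f m (srcs h x) = srcs h (f n x).
Proof.
rewrite /srcs -gmap_cast; move: (cast _ x) => {h x} y.
elim: (n - m) y => [|d IH] y //=.
by rewrite IH gmap_src.
Qed.

Lemma gmap_tgts (X Y : gset) (f : gmap X Y) m n (h : m <= n) (x : X n) :
  f m (tgts h x) = tgts h (f n x).
Proof.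
rewrite /tgts -gmap_cast; move: (cast _ x) => {h x} y.
elim: (n - m) y => [|d IH] y //=.
by rewrite IH gmap_tgt.
Qed.

Lemma ocomp_congr (C : omega_cat) k n (h : k < n) (x x' y y' : C n)
    (e : tgts (ltnW h) x = srcs (ltnW h) y)
    (e' : tgts (ltnW h) x' = srcs (ltnW h) y') :
  x = x' -> y = y' -> ocomp e = ocomp e'.
Proof. by move=> ex ey; subst x' y'; congr ocomp; exact: Prop_irrelevance. Qed.

Definition ofunctor_id (C : omega_cat) : ofunctor C C.
Proof.
refine (@OFunctor C C (gid C) (fun _ _ => erefl) _).
by move=> k n h x y e e'; apply: ocomp_congr.
Defined.

Definition ofunctor_comp (C D E : omega_cat) (G : ofunctor D E)
  (F : ofunctor C D) : ofunctor C E.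
Proof.
refine (@OFunctor C E (gcomp G F) _ _).
- by move=> n x /=; rewrite !ofun_id.
- move=> k n h x y e e' /=.
  have e1 : tgts (ltnW h) (F n x) = srcs (ltnW h) (F n y).
    by rewrite -gmap_tgts -gmap_srcs e.
  by rewrite (ofun_comp e e1) (ofun_comp e1 e').
Defined.

Section FreeMonad.
Variable F : free_omega.

Lemma ofunctor_ext (X : gset) (C : omega_cat) (G H : ofunctor (F X) C) :
  geq (gcomp G (feta F X)) (gcomp H (feta F X)) -> geq G H.
Proof.
move=> GH n x; rewrite (flift_uniq GH).
by rewrite -(@flift_uniq F X C (gcomp H (feta F X)) H).
Qed.

Definition fmap (X Y : gset) (f : gmap X Y) : ofunctor (F X) (F Y) :=
  flift F (gcomp (feta F Y) f).

Definition fmu (X : gset) : ofunctor (F (F X)) (F X) := flift F (gid (F X)).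

Lemma fmapE (X Y : gset) (f : gmap X Y) n (x : X n) :
  fmap f n (feta F X n x) = feta F Y n (f n x).
Proof. exact: (flift_eta F (gcomp (feta F Y) f) x). Qed.

Lemma fmuE (X : gset) n (x : F X n) : fmu X n (feta F (F X) n x) = x.
Proof. exact: (flift_eta F (gid (F X)) x). Qed.

Definition free_monad : gmonad.
Proof.
refine (@GMonad (fun X => F X) fmap (feta F) fmu _ _ _ _ _ _ _).
- move=> X; apply: (@ofunctor_ext X (F X) _ (ofunctor_id _)) => n x /=.
  by rewrite fmapE.
- move=> X Y Z g f.
  apply: (@ofunctor_ext X (F Z) _ (ofunctor_comp _ _)) => n x /=.
  by rewrite !fmapE.
- by move=> X Y f n x /=; rewrite fmapE.
- move=> X Y f.
  apply: (@ofunctor_ext (F X) (F Y) (ofunctor_comp _ _) (ofunctor_comp _ _)).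
  by move=> n x /=; rewrite fmapE !fmuE.
- by move=> X n x /=; rewrite fmuE.
- move=> X.
  apply: (@ofunctor_ext X (F X) (ofunctor_comp _ _) (ofunctor_id _)) => n x /=.
  by rewrite fmapE fmuE.
- move=> X.
  apply: (@ofunctor_ext _ _ (ofunctor_comp _ _) (ofunctor_comp _ _)).
  by move=> n x /=; rewrite fmapE !fmuE.
Defined.

End FreeMonad.

Section SubOmega.
Variables (C : omega_cat) (S : forall n, C n -> Prop).
Hypothesis S_src : forall n (x : C n.+1), S x -> S (src x).
Hypothesis S_tgt : forall n (x : C n.+1), S x -> S (tgt x).
Hypothesis S_oid : forall n (x : C n), S x -> S (oid x).
Hypothesis S_ocomp : forall k n (h : k < n) (x y : C n)
  (e : tgts (ltnW h) x = srcs (ltnW h) y), S x -> S y -> S (ocomp e).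

Let subcell n := {x : C n | S x}.

Lemma subcell_eq n (x y : subcell n) : sval x = sval y -> x = y.
Proof. by case: x y => [x Sx] [y Sy] /= exy; exact: eq_exist. Qed.

Definition sub_gset : gset.
Proof.
refine (@GSet subcell (fun n x => exist _ _ (S_src (svalP x)))
                      (fun n x => exist _ _ (S_tgt (svalP x))) _ _).
- by move=> n x; apply: subcell_eq; rewrite /= src_src.
- by move=> n x; apply: subcell_eq; rewrite /= tgt_src.
Defined.

Definition sub_incl : gmap sub_gset C :=
  @GMap sub_gset C (fun n x => sval x) (fun _ _ => erefl) (fun _ _ => erefl).

Lemma sub_srcs m n (h : m <= n) (x : sub_gset n) :
  sval (srcs h x) = srcs h (sval x).
Proof. exact: (gmap_srcs sub_incl). Qed.

Lemma sub_tgts m n (h : m <= n) (x : sub_gset n) :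
  sval (tgts h x) = tgts h (sval x).
Proof. exact: (gmap_tgts sub_incl). Qed.

Lemma sub_composable k n (h : k < n) (x y : sub_gset n) :
  tgts (ltnW h) x = srcs (ltnW h) y ->
  tgts (ltnW h) (sval x) = srcs (ltnW h) (sval y).
Proof.
by move=> e; rewrite -sub_tgts -sub_srcs e.
Qed.

Definition sub_oid n (x : sub_gset n) : sub_gset n.+1 :=
  exist _ _ (S_oid (svalP x)).

Definition sub_ocomp k n (h : k < n) (x y : sub_gset n)
    (e : tgts (ltnW h) x = srcs (ltnW h) y) : sub_gset n :=
  exist _ _ (S_ocomp (sub_composable e) (svalP x) (svalP y)).

Lemma sub_cast m n (e : m = n) (x : sub_gset m) :
  sval (cast e x) = cast e (sval x).
Proof. by case: n / e. Qed.

Lemma sub_ids m n (h : m <= n) (x : sub_gset m) :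
  sval (ids sub_oid h x) = ids (@oid C) h (sval x).
Proof.
rewrite /ids sub_cast; congr cast.
by elim: (n - m) => [|d IH] //=; rewrite IH.
Qed.

Definition sub_omega : omega_cat.
Proof.
refine (@OmegaCat sub_gset sub_oid sub_ocomp _ _ _ _ _ _ _ _ _ _ _).
- by move=> n x; apply: subcell_eq; rewrite /= src_oid.
- by move=> n x; apply: subcell_eq; rewrite /= tgt_oid.
- by move=> n h x y e; apply: subcell_eq; rewrite /= src_ocomp_top.
- by move=> n h x y e; apply: subcell_eq; rewrite /= tgt_ocomp_top.
- move=> k n h h' x y e e'; apply: subcell_eq => /=.
  exact: (src_ocomp _ (sub_composable e')).
- move=> k n h h' x y e e'; apply: subcell_eq => /=.
  exact: (tgt_ocomp _ (sub_composable e')).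
- move=> k n h x y z exy eyz e1 e2; apply: subcell_eq => /=.
  exact: (ocompA (sub_composable e1) (sub_composable e2)).
- move=> k n h x e; apply: subcell_eq => /=.
  have e' : tgts (ltnW h)
      (ids (@oid C) (ltnW h) (srcs (ltnW h) (sval x))) =
      srcs (ltnW h) (sval x).
    by have := sub_composable e; rewrite sub_ids sub_srcs.
  rewrite -[RHS](ocomp_idl e'); apply: ocomp_congr => //.
  by rewrite sub_ids sub_srcs.
- move=> k n h x e; apply: subcell_eq => /=.
  have e' : tgts (ltnW h) (sval x) = srcs (ltnW h)
      (ids (@oid C) (ltnW h) (tgts (ltnW h) (sval x))).
    by have := sub_composable e; rewrite sub_ids sub_tgts.
  rewrite -[RHS](ocomp_idr e'); apply: ocomp_congr => //.
  by rewrite sub_ids sub_tgts.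
- move=> k n h h' x y e e'; apply: subcell_eq => /=.
  exact: (oid_ocomp _ (sub_composable e')).
- move=> j k n hjk hk hj x y z w exy ezw exz eyw e1 e2; apply: subcell_eq => /=.
  exact: (ointerchange hjk (sub_composable e1) (sub_composable e2)).
Defined.

Definition sub_inclF : ofunctor sub_omega C.
Proof.
refine (@OFunctor sub_omega C sub_incl _ _) => // k n h x y e e'.
exact: ocomp_congr.
Defined.

End SubOmega.

Lemma free_omega_ind (F : free_omega) (X : gset)
    (S : forall n, F X n -> Prop) :
  (forall n (x : F X n.+1), S n.+1 x -> S n (src x)) ->
  (forall n (x : F X n.+1), S n.+1 x -> S n (tgt x)) ->
  (forall n (x : F X n), S n x -> S n.+1 (oid x)) ->
  (forall k n (h : k < n) (x y : F X n)
    (e : tgts (ltnW h) x = srcs (ltnW h) y), S n x -> S n y -> S n (ocomp e)) ->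
  (forall n (x : X n), S n (feta F X n x)) ->
  forall n (x : F X n), S n x.
Proof.
move=> Ss St Si Sc Se.
have @eta' : gmap X (sub_omega Ss St Si Sc).
  refine (@GMap X (sub_omega Ss St Si Sc)
                (fun n x => exist _ _ (Se n x)) _ _).
  - by move=> n x; apply: subcell_eq; rewrite /= gmap_src.
  - by move=> n x; apply: subcell_eq; rewrite /= gmap_tgt.
pose G := ofunctor_comp (sub_inclF Ss St Si Sc) (flift F eta').
have GE : geq G (ofunctor_id (F X)).
  apply: ofunctor_ext => n x /=.
  by have /= -> := flift_eta F eta' x.
by move=> n x; have /= <- := GE n x; exact: svalP.
Qed.

Record contracted (F : free_omega) := Contracted {
  cmonad :> gmonad;
  ar : monad_map cmonad (free_monad F);
  ar_cartesian : forall (X Y : gset) (f : gmap X Y),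
    is_pullback (mmap cmonad f) (ar X) (ar Y) (mmap (free_monad F) f);
  kappa : forall n (phi phi' : cmonad gone n) (k : F gone n.+1),
    parallel phi phi' ->
    src k = ar gone n phi -> tgt k = ar gone n phi' -> cmonad gone n.+1;
  src_kappa : forall n phi phi' k p e e',
    src (@kappa n phi phi' k p e e') = phi;
  tgt_kappa : forall n phi phi' k p e e',
    tgt (@kappa n phi phi' k p e e') = phi';
  ar_kappa : forall n phi phi' k p e e',
    ar gone n.+1 (@kappa n phi phi' k p e e') = k }.

Record contracted_map (F : free_omega) (P Q : contracted F) := ContractedMap {
  cmap :> monad_map P Q;
  cmap_ar : forall X, geq (gcomp (ar Q X) (cmap X)) (ar P X);
  cmap_kappa : forall n (phi phi' : P gone n) (k : F gone n.+1)
    (p : parallel phi phi')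
    (e : src k = ar P gone n phi) (e' : tgt k = ar P gone n phi')
    (q : parallel (cmap gone n phi) (cmap gone n phi'))
    (d : src k = ar Q gone n (cmap gone n phi))
    (d' : tgt k = ar Q gone n (cmap gone n phi')),
    cmap gone n.+1 (kappa p e e') = kappa q d d' }.

Definition initial_contracted (F : free_omega) (L : contracted F) : Prop :=
  forall P : contracted F, exists f : contracted_map L P,
    forall (g : contracted_map L P) (X : gset), geq (g X) (f X).

Section PastingSchemes.
Variable F : free_omega.

Lemma srcs_src (X : gset) k n (h : k <= n.+1) (h' : k <= n) (x : X n.+1) :
  srcs h x = srcs h' (src x).
Proof.
rewrite /srcs; move: (esym (subnK h)) (esym (subnK h')).
rewrite subSn //; move: (n - k) => d e e'.
by subst n; rewrite (eq_irrelevance e erefl).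
Qed.

Lemma tgts_tgt (X : gset) k n (h : k <= n.+1) (h' : k <= n) (x : X n.+1) :
  tgts h x = tgts h' (tgt x).
Proof.
rewrite /tgts; move: (esym (subnK h)) (esym (subnK h')).
rewrite subSn //; move: (n - k) => d e e'.
by subst n; rewrite (eq_irrelevance e erefl).
Qed.

Fixpoint loop n : F gone n -> Prop :=
  match n with
  | 0 => fun k => k = feta F gone 0 tt
  | m.+1 => fun k => src k = tgt k /\ loop (src k)
  end.

Lemma loopP n (k : F gone n) : loop k.
Proof.
move: n k; apply: free_omega_ind.
- by move=> n x [].
- by move=> n x [<-].
- by move=> n x lx; split; rewrite ?src_oid ?tgt_oid.
- move=> k n; elim: n => [//|n IH] h x y e [ex lx] [ey ly].
  have [hk|hk] := ltnP k n.
    have e' : tgts (ltnW hk) (src x) = srcs (ltnW hk) (src y).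
      by rewrite {1}ex -(srcs_src (ltnW h)) -(tgts_tgt (ltnW h)).
    have e'' : tgts (ltnW hk) (tgt x) = srcs (ltnW hk) (tgt y).
      by rewrite -ex -ey.
    split; rewrite (src_ocomp e e'); last exact: IH.
    by rewrite (tgt_ocomp e e''); exact: ocomp_congr.
  have ekn : k = n by apply/eqP; rewrite eqn_leq hk andbT -ltnS.
  subst k; split; rewrite src_ocomp_top ?tgt_ocomp_top //.
  rewrite -ey ex; move: e.
  rewrite (tgts_tgt _ (leqnn n)) (srcs_src _ (leqnn n)).
  rewrite /tgts /srcs; move: (esym (subnK (leqnn n))); rewrite subnn => e.
  by rewrite (eq_irrelevance e erefl).
- elim=> [|n IH] [] //=; split; first by rewrite -gmap_src -gmap_tgt.
  by rewrite -gmap_src; exact: IH.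
Qed.

Variable P : contracted F.

Lemma ar_eta n (k : F gone n) :
  k = feta F gone n tt -> ar P gone n (meta P gone n tt) = k.
Proof. by move=> ->; exact: (mm_eta (ar P)). Qed.

Lemma parallel_refl (X : gset) n (x : X n) : parallel x x.
Proof. by case: n x. Qed.

Lemma tgt_loop n (k : F gone n.+1) (phi : P gone n) :
  ar P gone n phi = src k -> tgt k = ar P gone n phi.
Proof. by move=> ->; rewrite (proj1 (loopP k)). Qed.

(* A cell of T1 that is not of the form eta(tt) is positive-dimensional and   *)
(* has equal source and target.                                               *)
Fixpoint sp_sig n :
  forall k : F gone n, {phi : P gone n | ar P gone n phi = k} :=
  match n with
  | 0 => fun k => exist _ (meta P gone 0 tt) (ar_eta (loopP k))
  | m.+1 => fun k =>
      match pselect (k = feta F gone m.+1 tt) with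
      | left e => exist _ (meta P gone m.+1 tt) (ar_eta e)
      | right _ =>
          let: exist phi e := sp_sig (src k) in
          exist _ (kappa (parallel_refl phi) (esym e) (tgt_loop e))
                  (ar_kappa (parallel_refl phi) (esym e) (tgt_loop e))
      end
  end.

Definition sp n (k : F gone n) : P gone n := sval (sp_sig k).

Lemma ar_sp n (k : F gone n) : ar P gone n (sp k) = k.
Proof. exact: (svalP (sp_sig k)). Qed.

(* [kappa] as a total function; the value outside the domain is immaterial.   *)
Definition kappa_tot n (phi phi' : P gone n) (k : F gone n.+1) : P gone n.+1 :=
  match pselect [/\ parallel phi phi', src k = ar P gone n phi
                  & tgt k = ar P gone n phi'] with
  | left h => let: And3 p e e' := h in kappa p e e'
  | right _ => sp k
  end.

Lemma ar_kappa_tot n (phi phi' : P gone n) (k : F gone n.+1) :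
  ar P gone n.+1 (kappa_tot phi phi' k) = k.
Proof.
rewrite /kappa_tot; case: pselect => [[p e e']|_]; last exact: ar_sp.
exact: ar_kappa.
Qed.

Definition shape_of (X : gset) n (u : F X n) : F gone n :=
  fmap F (gbang X) n u.

Lemma mkcell_ex (X : gset) n (phi : P gone n) (u : F X n) (k : F gone n) :
  ar P gone n phi = k -> shape_of u = k ->
  exists z : P X n, mmap P (gbang X) n z = phi /\ ar P X n z = u.
Proof.
move=> hphi hu.
have [_ univ] := ar_cartesian P (gbang X).
pose cells m := {q : P gone m * F X m | ar P gone m q.1 = shape_of q.2}.
have cells_eq m (x y : cells m) : sval x = sval y -> x = y.
  by case: x y => [x ex] [y ey] /= exy; exact: eq_exist.
have s_cell m (q : cells m.+1) :
    ar P gone m (src (sval q).1) = shape_of (src (sval q).2).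
  by rewrite gmap_src (svalP q) /shape_of gmap_src.
have t_cell m (q : cells m.+1) :
    ar P gone m (tgt (sval q).1) = shape_of (tgt (sval q).2).
  by rewrite gmap_tgt (svalP q) /shape_of gmap_tgt.
have @Z : gset.
  refine (@GSet cells
    (fun m q => exist _ (src (sval q).1, src (sval q).2) (s_cell m q))
    (fun m q => exist _ (tgt (sval q).1, tgt (sval q).2) (t_cell m q)) _ _).
  - by move=> m q; apply: cells_eq; rewrite /= !src_src.
  - by move=> m q; apply: cells_eq; rewrite /= !tgt_src.
pose z1 : gmap Z (P gone) :=
  @GMap Z (P gone) (fun m q => (sval q).1)
        (fun _ _ => erefl) (fun _ _ => erefl).
pose z2 : gmap Z (F X) :=
  @GMap Z (F X) (fun m q => (sval q).2) (fun _ _ => erefl) (fun _ _ => erefl).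
have [m [m1 m2 _]] := univ Z z1 z2 (fun m q => svalP q).
pose q : cells n := exist _ (phi, u) (etrans hphi (esym hu)).
by exists (m n q); split; [exact: m1 | exact: m2].
Qed.

(* The cell (phi, u) of PX, which is the pullback of P1 and TX over T1.       *)
Definition mkcell (X : gset) n (phi : P gone n) (u : F X n) (k : F gone n)
    (hphi : ar P gone n phi = k) (hu : shape_of u = k) : P X n :=
  sval (cid (mkcell_ex hphi hu)).

Definition act (A : algebra P) n (phi : P gone n) (u : F A n) (k : F gone n)
    (hphi : ar P gone n phi = k) (hu : shape_of u = k) : A n :=
  astr A n (mkcell hphi hu).
Arguments act {A n} phi u {k} hphi hu.

Definition wid (A : algebra P) n (x : A n) : A n.+1 :=
  let u : F A n.+1 := oid (feta F A n x) in
  act (sp (shape_of u)) u (ar_sp (shape_of u)) erefl.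

Definition wcomp (A : algebra P) k m1 m2 n (e : maxn m1 m2 = n)
    (h1 : k < m1) (h2 : k < m2) (x : A m1) (y : A m2) : A n :=
  let u : F A n := mcomp e h1 h2 (feta F A m1 x) (feta F A m2 y) in
  act (sp (shape_of u)) u (ar_sp (shape_of u)) erefl.

CoInductive invertible (A : algebra P) n (u : A n.+1) : Prop :=
  Invertible (v : A n.+1)
    (_ : src v = tgt u) (_ : tgt v = src u)
    (p : A n.+2)
    (_ : src p = wcomp (maxnn n.+1) (ltnSn n) (ltnSn n) u v)
    (_ : tgt p = wid (src u))
    (_ : invertible p)
    (q : A n.+2)
    (_ : src q = wcomp (maxnn n.+1) (ltnSn n) (ltnSn n) v u)
    (_ : tgt q = wid (tgt u))
    (_ : invertible q).

Lemma maxn_ltl j m : j < m -> maxn j.+1 m = m.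
Proof. by move/maxn_idPr. Qed.

Lemma maxn_ltr j m : j < m -> maxn m j.+1 = m.
Proof. by move/maxn_idPl. Qed.

(* l *_j (x *_j r) for (j+1)-cells l, r and an m-cell x. *)
Definition whisker (A : algebra P) j m (h : j < m)
    (l : A j.+1) (x : A m) (r : A j.+1) : A m :=
  wcomp (maxn_ltl h) (ltnSn j) h l
        (wcomp (maxn_ltr h) h (ltnSn j) x r).

Section PaddingInstructions.
Variables (n : nat) (phi chi : P gone n) (k : F gone n).

(* lambda_(j+1) and rho_(j+1) as functions of p = phi_j. The case j = n is    *)
(* lambda_(n+1), rho_(n+1), as srcs and tgts are then identities.             *)
Definition lam_of j (h : j <= n) (p : P gone n) : P gone j.+1 :=
  kappa_tot (srcs h chi) (srcs h p) (oid (srcs h k)).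

Definition rho_of j (h : j <= n) (p : P gone n) : P gone j.+1 :=
  kappa_tot (tgts h p) (tgts h chi) (oid (tgts h k)).

Fixpoint pad_phi (i : nat) : i <= n -> P gone n :=
  match i with
  | 0 => fun _ => phi
  | j.+1 => fun h : j < n =>
      let p := pad_phi (ltnW h) in
      whisker (A := free_algebra P gone) h
        (lam_of (ltnW h) p) p (rho_of (ltnW h) p)
  end.

Definition pad_lam j (h : j <= n) : P gone j.+1 := lam_of h (pad_phi h).
Definition pad_rho j (h : j <= n) : P gone j.+1 := rho_of h (pad_phi h).

Lemma ar_pad_lam j (h : j <= n) :
  ar P gone j.+1 (pad_lam h) = oid (srcs h k).
Proof. exact: ar_kappa_tot. Qed.

Lemma ar_pad_rho j (h : j <= n) :
  ar P gone j.+1 (pad_rho h) = oid (tgts h k).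
Proof. exact: ar_kappa_tot. Qed.

Lemma shape_id_srcs (X : gset) (u : F X n) j (h : j <= n) :
  shape_of u = k -> shape_of (oid (srcs h u)) = oid (srcs h k).
Proof. by move=> <-; rewrite /shape_of ofun_id gmap_srcs. Qed.

Lemma shape_id_tgts (X : gset) (u : F X n) j (h : j <= n) :
  shape_of u = k -> shape_of (oid (tgts h u)) = oid (tgts h k).
Proof. by move=> <-; rewrite /shape_of ofun_id gmap_tgts. Qed.

Variables (A : algebra P) (u v : F A n).
Hypotheses (hu : shape_of u = k) (hv : shape_of v = k).

Definition pad_l j (h : j <= n) : A j.+1 :=
  act (pad_lam h) (oid (srcs h u)) (ar_pad_lam h) (shape_id_srcs h hu).

Definition pad_r j (h : j <= n) : A j.+1 :=
  act (pad_rho h) (oid (tgts h v)) (ar_pad_rho h) (shape_id_tgts h hv).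

Fixpoint pad_iter (w : A n.+1) (i : nat) : i <= n.+1 -> A n.+1 :=
  match i with
  | 0 => fun _ => w
  | j.+1 => fun h : j < n.+1 =>
      whisker h (pad_l (h : j <= n)) (pad_iter w (ltnW h)) (pad_r (h : j <= n))
  end.

Definition padding (w : A n.+1) : A n.+1 := pad_iter w (leqnn n.+1).

End PaddingInstructions.

End PastingSchemes.

Arguments act {F P A n} phi u {k} hphi hu.
Arguments padding {F P n} phi chi {k A} u v hu hv w.

(* Main.v *)
(* An n-cell of LX is determined by its components in L1 and TX, and the      *)
(* binary composites of the free algebra LX are computed componentwise. So    *)
(* the padding construction lifts along xi : LX -> X: replacing w by the cell *)
(* (phidot, W) of LX one obtains a cell (psi, W), since whiskering with       *)
(* identities does not change W, where psi : chi -> chi has arity kdot and    *)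
(* xi(psi, W) is the padding of w. The contraction of L1 then gives           *)
(* theta : psi -> chidot over the identity of kdot, and c = xi(theta, id W).  *)
(* Every cell xi(theta, id U) is invertible, by coinduction: an inverse and   *)
(* the two cancellation cells, all lying over identities, come from the       *)
(* contraction.                                                               *)

From mathcomp Require Import all_boot.
From mathcomp Require Import boolp.
Require Import Defs.

Set Implicit Arguments.
Unset Strict Implicit.
Unset Printing Implicit Defensive.

(** Write [P] for [L]. A cell of [P X] is a pair of an instruction and a diagram ([mkcell],
    [cell_ext]). Weak identities and composites are values of one globular map [spact] on strict
    expressions, so their boundaries and their behaviour under morphisms follow from strict laws.
    The padding can therefore be computed in [P X]: start from the pair of the given instruction
    [phidot] and [W], and whisker it with the pairs of lambda_i, rho_i and identity diagrams. The
    structure map sends the result to the padding of [w] ([astr_lift]), its diagram is still [W] by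
    the strict unit laws ([ar_whisker]), and its instruction ends up with boundary [chi]
    ([padding_lift]).

    This lift and the pair of [chidot] and [W] are parallel cells of [P X] with the same diagram, so
    the contraction joins them by a cell over the identity of [W] ([contract]). Its image in [X] has
    the required ends. It is invertible because the images of cells over identity diagrams form a
    class that contains inverses and cancellation cells for its members, obtained again by
    contraction ([invertible_astr]). *)

(** * Globularity for iterated sources and targets *)

Section IteratedBoundaries.
Variable X : gset.

Lemma srcs_id n (h : n <= n) (x : X n) : srcs h x = x.
Proof.
rewrite /srcs; move: (esym (subnK h)); rewrite subnn => e.
by rewrite (eq_irrelevance e erefl).
Qed.

Lemma tgts_id n (h : n <= n) (x : X n) : tgts h x = x.
Proof.
rewrite /tgts; move: (esym (subnK h)); rewrite subnn => e.
by rewrite (eq_irrelevance e erefl).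
Qed.

(** The strict bound matters: at [k = n] the two sides are the source and the target of [x]. *)
Lemma srcs_tgt k n (h : k <= n.+1) (h' : k <= n) (x : X n.+1) :
  k < n -> srcs h x = srcs h' (tgt x).
Proof.
move=> kn; rewrite (srcs_src h h'); case: n kn h h' x => // n kn h h' x.
by rewrite !(srcs_src h' (kn : k <= n)) src_src.
Qed.

Lemma tgts_src k n (h : k <= n.+1) (h' : k <= n) (x : X n.+1) :
  k < n -> tgts h x = tgts h' (src x).
Proof.
move=> kn; rewrite (tgts_tgt h h'); case: n kn h h' x => // n kn h h' x.
by rewrite !(tgts_tgt h' (kn : k <= n)) tgt_src.
Qed.

Lemma src_srcs k n (h : k < n) (h' : k <= n) (x : X n) :
  src (srcs h x) = srcs h' x.
Proof.
elim: n h h' x => // n IH h h' x.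
have [kn|nk] := ltnP k n.
  by rewrite (srcs_src h kn) (IH kn (ltnW kn)) (srcs_src h' (ltnW kn)).
have ekn : k = n by apply/eqP; rewrite eqn_leq nk andbT -ltnS.
by subst k; rewrite srcs_id (srcs_src h' (leqnn n)) srcs_id.
Qed.

Lemma tgt_srcs k n (h : k < n) (h' : k <= n) (x : X n) :
  tgt (srcs h x) = tgts h' x.
Proof.
elim: n h h' x => // n IH h h' x.
have [kn|nk] := ltnP k n.
  by rewrite (srcs_src h kn) (IH kn (ltnW kn)) (tgts_src h' (ltnW kn)).
have ekn : k = n by apply/eqP; rewrite eqn_leq nk andbT -ltnS.
by subst k; rewrite srcs_id (tgts_tgt h' (leqnn n)) tgts_id.
Qed.

Lemma tgt_tgts k n (h : k < n) (h' : k <= n) (x : X n) :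
  tgt (tgts h x) = tgts h' x.
Proof.
elim: n h h' x => // n IH h h' x.
have [kn|nk] := ltnP k n.
  by rewrite (tgts_tgt h kn) (IH kn (ltnW kn)) (tgts_tgt h' (ltnW kn)).
have ekn : k = n by apply/eqP; rewrite eqn_leq nk andbT -ltnS.
by subst k; rewrite tgts_id (tgts_tgt h' (leqnn n)) tgts_id.
Qed.

Lemma src_tgts k n (h : k < n) (h' : k <= n) (x : X n) :
  src (tgts h x) = srcs h' x.
Proof.
elim: n h h' x => // n IH h h' x.
have [kn|nk] := ltnP k n.
  by rewrite (tgts_tgt h kn) (IH kn (ltnW kn)) (srcs_tgt h' (ltnW kn)).
have ekn : k = n by apply/eqP; rewrite eqn_leq nk andbT -ltnS.
by subst k; rewrite tgts_id (srcs_src h' (leqnn n)) srcs_id.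
Qed.

Lemma srcs_top n (h : n <= n.+1) (x : X n.+1) : srcs h x = src x.
Proof. by rewrite (srcs_src h (leqnn n)) srcs_id. Qed.

Lemma tgts_top n (h : n <= n.+1) (x : X n.+1) : tgts h x = tgt x.
Proof. by rewrite (tgts_tgt h (leqnn n)) tgts_id. Qed.

End IteratedBoundaries.

(** * Boundaries and unit laws of strict composites *)

Section StrictComposition.
Variable C : omega_cat.

Lemma ids_id n (h : n <= n) (x : C n) : ids (@oid C) h x = x.
Proof.
rewrite /ids; move: (subnK h); rewrite subnn => e.
by rewrite (eq_irrelevance e erefl).
Qed.

Lemma ids_oid m n (h : m <= n) (h' : m <= n.+1) (x : C m) :
  ids (@oid C) h' x = oid (ids (@oid C) h x).
Proof.
rewrite /ids; move: (subnK h) (subnK h').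
rewrite subSn //; move: (n - m) => d e e'.
by subst n; rewrite (eq_irrelevance e' erefl).
Qed.

(** Lets [mcomp] absorb an identity cell: inflating it gives the iterated identity of its boundary,
    the form in which the unit laws are stated. *)
Lemma ids_of_oid m n (h : m < n) (h' : m <= n) (x : C m) :
  ids (@oid C) h (oid x) = ids (@oid C) h' x.
Proof.
elim: n h h' => // n IH h h'.
have [mn|nm] := ltnP m n.
  by rewrite (ids_oid mn) (IH mn (ltnW mn)) -(ids_oid (ltnW mn)).
have emn : m = n by apply/eqP; rewrite eqn_leq nm andbT -ltnS.
by subst m; rewrite ids_id (ids_oid (leqnn n)) ids_id.
Qed.

Lemma srcs_ids k m n (h : m <= n) (hk : k <= n) (hk' : k <= m) (x : C m) :
  srcs hk (ids (@oid C) h x) = srcs hk' x.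
Proof.
elim: n h hk => [|n IH] h hk.
  have e : m = 0 by case: (m) h.
  subst m; rewrite ids_id; congr srcs; exact: Prop_irrelevance.
have [mn|nm] := leqP m n.
  by rewrite (ids_oid mn) (srcs_src hk (leq_trans hk' mn)) src_oid IH.
have e : m = n.+1 by apply/eqP; rewrite eqn_leq h.
subst m; rewrite ids_id; congr srcs; exact: Prop_irrelevance.
Qed.

Lemma tgts_ids k m n (h : m <= n) (hk : k <= n) (hk' : k <= m) (x : C m) :
  tgts hk (ids (@oid C) h x) = tgts hk' x.
Proof.
elim: n h hk => [|n IH] h hk.
  have e : m = 0 by case: (m) h.
  subst m; rewrite ids_id; congr tgts; exact: Prop_irrelevance.
have [mn|nm] := leqP m n.
  by rewrite (ids_oid mn) (tgts_tgt hk (leq_trans hk' mn)) tgt_oid IH.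
have e : m = n.+1 by apply/eqP; rewrite eqn_leq h.
subst m; rewrite ids_id; congr tgts; exact: Prop_irrelevance.
Qed.

Lemma scompE k n (h : k < n) (x y : C n)
    (e : tgts (ltnW h) x = srcs (ltnW h) y) : scomp h x y = ocomp e.
Proof. by rewrite /scomp; case: pselect => // e'; exact: ocomp_congr. Qed.

Lemma src_scomp k n (h : k < n.+1) (h' : k < n) (x y : C n.+1) :
  tgts (ltnW h) x = srcs (ltnW h) y ->
  src (scomp h x y) = scomp h' (src x) (src y).
Proof.
move=> e; have e' : tgts (ltnW h') (src x) = srcs (ltnW h') (src y).
  by rewrite -(tgts_src (ltnW h)) // e (srcs_src _ (ltnW h')).
by rewrite (scompE e) (scompE e') (src_ocomp e e').
Qed.

Lemma tgt_scomp k n (h : k < n.+1) (h' : k < n) (x y : C n.+1) :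
  tgts (ltnW h) x = srcs (ltnW h) y ->
  tgt (scomp h x y) = scomp h' (tgt x) (tgt y).
Proof.
move=> e; have e' : tgts (ltnW h') (tgt x) = srcs (ltnW h') (tgt y).
  by rewrite -(srcs_tgt (ltnW h)) // -e (tgts_tgt _ (ltnW h')).
by rewrite (scompE e) (scompE e') (tgt_ocomp e e').
Qed.

Lemma srcs_scomp k n (h : k < n) (x y : C n) :
  tgts (ltnW h) x = srcs (ltnW h) y ->
  srcs (ltnW h) (scomp h x y) = srcs (ltnW h) x.
Proof.
elim: n h x y => // n IH h x y e; have [kn|nk] := ltnP k n.
  rewrite !(srcs_src (ltnW h) (ltnW kn)) (src_scomp kn) // IH //.
  by rewrite -(tgts_src (ltnW h)) // e (srcs_src _ (ltnW kn)).
have ekn : k = n by apply/eqP; rewrite eqn_leq nk andbT -ltnS.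
by subst k; rewrite !srcs_top (scompE e) src_ocomp_top.
Qed.

Lemma tgts_scomp k n (h : k < n) (x y : C n) :
  tgts (ltnW h) x = srcs (ltnW h) y ->
  tgts (ltnW h) (scomp h x y) = tgts (ltnW h) y.
Proof.
elim: n h x y => // n IH h x y e; have [kn|nk] := ltnP k n.
  rewrite !(tgts_tgt (ltnW h) (ltnW kn)) (tgt_scomp kn) // IH //.
  by rewrite -(srcs_tgt (ltnW h)) // -e (tgts_tgt _ (ltnW kn)).
have ekn : k = n by apply/eqP; rewrite eqn_leq nk andbT -ltnS.
by subst k; rewrite !tgts_top (scompE e) tgt_ocomp_top.
Qed.

Lemma scomp_idl k n (h : k < n) (x : C n) :
  scomp h (ids (@oid C) (ltnW h) (srcs (ltnW h) x)) x = x.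
Proof.
have e : tgts (ltnW h) (ids (@oid C) (ltnW h) (srcs (ltnW h) x))
         = srcs (ltnW h) x by rewrite (tgts_ids _ _ (leqnn k)) tgts_id.
by rewrite (scompE e) ocomp_idl.
Qed.

Lemma scomp_idr k n (h : k < n) (x : C n) :
  scomp h x (ids (@oid C) (ltnW h) (tgts (ltnW h) x)) = x.
Proof.
have e : tgts (ltnW h) x
         = srcs (ltnW h) (ids (@oid C) (ltnW h) (tgts (ltnW h) x)).
  by rewrite (srcs_ids _ _ (leqnn k)) srcs_id.
by rewrite (scompE e) ocomp_idr.
Qed.

Variables (k m1 m2 n : nat) (e : maxn m1 m2 = n) (h1 : k < m1) (h2 : k < m2).
Variables (x : C m1) (y : C m2).
Hypothesis xy : tgts (ltnW h1) x = srcs (ltnW h2) y.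

Lemma mcomp_composable (h : k <= n) :
  tgts h (ids (@oid C) (leq_maxl_eq e) x) =
  srcs h (ids (@oid C) (leq_maxr_eq e) y).
Proof. by rewrite (tgts_ids _ _ (ltnW h1)) (srcs_ids _ _ (ltnW h2)). Qed.

Lemma srcs_mcomp (h : k <= n) : srcs h (mcomp e h1 h2 x y) = srcs (ltnW h1) x.
Proof.
rewrite (Prop_irrelevance h (ltnW (ltn_maxl e h1))).
by rewrite srcs_scomp ?mcomp_composable // (srcs_ids _ _ (ltnW h1)).
Qed.

Lemma tgts_mcomp (h : k <= n) : tgts h (mcomp e h1 h2 x y) = tgts (ltnW h2) y.
Proof.
rewrite (Prop_irrelevance h (ltnW (ltn_maxl e h1))).
by rewrite tgts_scomp ?mcomp_composable // (tgts_ids _ _ (ltnW h2)).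
Qed.

End StrictComposition.

(** * Strict functors and composites of cells of different dimensions *)

Section StrictFunctors.
Variables (C D : omega_cat) (G : ofunctor C D).

Lemma ofun_ids m n (h : m <= n) (x : C m) :
  G n (ids (@oid C) h x) = ids (@oid D) h (G m x).
Proof.
rewrite /ids gmap_cast; congr cast.
by elim: (n - m) => [|d IH] //=; rewrite ofun_id IH.
Qed.

Lemma ofun_mcomp k m1 m2 n (e : maxn m1 m2 = n) (h1 : k < m1) (h2 : k < m2)
    (x : C m1) (y : C m2) :
  tgts (ltnW h1) x = srcs (ltnW h2) y ->
  G n (mcomp e h1 h2 x y) = mcomp e h1 h2 (G m1 x) (G m2 y).
Proof.
move=> xy; rewrite /mcomp; set h := ltn_maxl e h1.
have xy' := mcomp_composable e xy (ltnW h).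
have Gxy : tgts (ltnW h) (G n (ids (@oid C) (leq_maxl_eq e) x)) =
           srcs (ltnW h) (G n (ids (@oid C) (leq_maxr_eq e) y)).
  by rewrite -gmap_tgts -gmap_srcs xy'.
by rewrite (scompE xy') (ofun_comp _ Gxy) -(scompE Gxy) !ofun_ids.
Qed.

End StrictFunctors.

(** * Whiskering in a strict omega-category *)

Section StrictWhiskering.
Variable C : omega_cat.

Lemma ids_irrelevance m n (h h' : m <= n) (x : C m) :
  ids (@oid C) h x = ids (@oid C) h' x.
Proof. by rewrite (Prop_irrelevance h h'). Qed.

Lemma scomp_congr k n (h h' : k < n) (x x' y y' : C n) :
  x = x' -> y = y' -> scomp h x y = scomp h' x' y'.
Proof. by move=> -> ->; rewrite (Prop_irrelevance h h'). Qed.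

Variables (j m : nat) (h : j < m).

Lemma mcomp_oidl (x : C m) :
  mcomp (maxn_ltl h) (ltnSn j) h (oid (srcs (ltnW h) x)) x = x.
Proof.
rewrite /mcomp ids_id (ids_of_oid _ (ltnW h)) -[RHS](scomp_idl h).
by apply: scomp_congr => //; exact: ids_irrelevance.
Qed.

Lemma mcomp_oidr (x : C m) :
  mcomp (maxn_ltr h) h (ltnSn j) x (oid (tgts (ltnW h) x)) = x.
Proof.
rewrite /mcomp ids_id (ids_of_oid _ (ltnW h)) -[RHS](scomp_idr h).
by apply: scomp_congr => //; exact: ids_irrelevance.
Qed.

Variable h' : j < m.+1.

(** As [l] has dimension j+1 <= m, it enters the composite in dimension m+1 as an iterated identity,
    whose boundary is its copy in dimension m. So only [x] changes. *)
Lemma src_mcompl (l : C j.+1) (x : C m.+1) :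
  tgt l = srcs (ltnW h') x ->
  src (mcomp (maxn_ltl h') (ltnSn j) h' l x) =
  mcomp (maxn_ltl h) (ltnSn j) h l (src x).
Proof.
move=> lx; have c : tgts (ltnW (ltnSn j)) l = srcs (ltnW h') x.
  by rewrite tgts_top.
rewrite /mcomp (src_scomp h); last exact: (mcomp_composable _ c).
rewrite !ids_id (ids_oid h) src_oid; apply: scomp_congr => //.
exact: ids_irrelevance.
Qed.

Lemma tgt_mcompl (l : C j.+1) (x : C m.+1) :
  tgt l = srcs (ltnW h') x ->
  tgt (mcomp (maxn_ltl h') (ltnSn j) h' l x) =
  mcomp (maxn_ltl h) (ltnSn j) h l (tgt x).
Proof.
move=> lx; have c : tgts (ltnW (ltnSn j)) l = srcs (ltnW h') x.
  by rewrite tgts_top.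
rewrite /mcomp (tgt_scomp h); last exact: (mcomp_composable _ c).
rewrite !ids_id (ids_oid h) tgt_oid; apply: scomp_congr => //.
exact: ids_irrelevance.
Qed.

Lemma src_mcompr (x : C m.+1) (r : C j.+1) :
  src r = tgts (ltnW h') x ->
  src (mcomp (maxn_ltr h') h' (ltnSn j) x r) =
  mcomp (maxn_ltr h) h (ltnSn j) (src x) r.
Proof.
move=> xr; have c : tgts (ltnW h') x = srcs (ltnW (ltnSn j)) r.
  by rewrite srcs_top.
rewrite /mcomp (src_scomp h); last exact: (mcomp_composable _ c).
rewrite !ids_id (ids_oid h) src_oid; apply: scomp_congr => //.
exact: ids_irrelevance.
Qed.

Lemma tgt_mcompr (x : C m.+1) (r : C j.+1) :
  src r = tgts (ltnW h') x ->
  tgt (mcomp (maxn_ltr h') h' (ltnSn j) x r) =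
  mcomp (maxn_ltr h) h (ltnSn j) (tgt x) r.
Proof.
move=> xr; have c : tgts (ltnW h') x = srcs (ltnW (ltnSn j)) r.
  by rewrite srcs_top.
rewrite /mcomp (tgt_scomp h); last exact: (mcomp_composable _ c).
rewrite !ids_id (ids_oid h) tgt_oid; apply: scomp_congr => //.
exact: ids_irrelevance.
Qed.

End StrictWhiskering.

Lemma mcomp_oid (C : omega_cat) n (x : C n) :
  mcomp (maxnn n.+1) (ltnSn n) (ltnSn n) (oid x) (oid x) = oid x.
Proof.
rewrite /mcomp !ids_id -[RHS](scomp_idl (ltnSn n)) srcs_top src_oid.
rewrite (ids_oid (leqnn n)) ids_id.
by apply: scomp_congr => //; exact: ids_irrelevance.
Qed.

Lemma gmap_ext (X Y : gset) (f g : gmap X Y) : geq f g -> f = g.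
Proof.
case: f g => [f fs ft] [g gs gt] fg; have {}fg : f = g.
  by do 2!apply: functional_extensionality_dep => ?; exact: fg.
subst g; congr GMap; exact: Prop_irrelevance.
Qed.

(** * Cells of [P X] as pairs of an instruction and a diagram *)

Section Contracted.
Variables (F : free_omega) (P : contracted F).

Lemma shape_gmap (X Y : gset) (f : gmap X Y) n (u : F X n) :
  shape_of (fmap F f n u) = shape_of u.
Proof.
rewrite /shape_of.
suff E : geq (ofunctor_comp (fmap F (gbang Y)) (fmap F f)) (fmap F (gbang X)).
  exact: E.
by apply: ofunctor_ext => p x /=; rewrite !fmapE.
Qed.

Lemma shape_feta (X : gset) n (x : X n) :
  shape_of (feta F X n x) = feta F gone n tt.
Proof. exact: fmapE. Qed.

(* The concrete pullback of P1 and TX over T1 also maps to PX, and uniqueness *)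
(* of mediating maps makes the comparison map out of PX injective.            *)
Lemma cell_ext (X : gset) n (x y : P X n) :
  mmap P (gbang X) n x = mmap P (gbang X) n y -> ar P X n x = ar P X n y ->
  x = y.
Proof.
move=> e1 e2; have [comm univ] := ar_cartesian P (gbang X).
pose cells m := {q : P gone m * F X m | ar P gone m q.1 = shape_of q.2}.
have cells_eq m (a b : cells m) : sval a = sval b -> a = b.
  by case: a b => [a ea] [b eb] /= ab; exact: eq_exist.
have s_cell m (q : cells m.+1) :
    ar P gone m (src (sval q).1) = shape_of (src (sval q).2).
  by rewrite gmap_src (svalP q) /shape_of gmap_src.
have t_cell m (q : cells m.+1) :
    ar P gone m (tgt (sval q).1) = shape_of (tgt (sval q).2).
  by rewrite gmap_tgt (svalP q) /shape_of gmap_tgt.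
have @Z : gset.
  refine (@GSet cells
    (fun m q => exist _ (src (sval q).1, src (sval q).2) (s_cell m q))
    (fun m q => exist _ (tgt (sval q).1, tgt (sval q).2) (t_cell m q)) _ _).
  - by move=> m q; apply: cells_eq; rewrite /= !src_src.
  - by move=> m q; apply: cells_eq; rewrite /= !tgt_src.
pose z1 : gmap Z (P gone) :=
  @GMap Z (P gone) (fun m q => (sval q).1)
        (fun _ _ => erefl) (fun _ _ => erefl).
pose z2 : gmap Z (F X) :=
  @GMap Z (F X) (fun m q => (sval q).2) (fun _ _ => erefl) (fun _ _ => erefl).
have @c : gmap (P X) Z.
  refine (@GMap (P X) Z
    (fun m z => exist _ (mmap P (gbang X) m z, ar P X m z) (comm m z)) _ _).
  - by move=> m z; apply: (@cells_eq _); rewrite /= !gmap_src.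
  - by move=> m z; apply: (@cells_eq _); rewrite /= !gmap_tgt.
have [med [m1 m2 _]] := univ Z z1 z2 (fun m q => svalP q).
have [id' [_ _ uniq]] := univ _ (mmap P (gbang X)) (ar P X) comm.
have cK m (z : P X m) : med m (c m z) = z.
  have E1 : geq (gcomp (mmap P (gbang X)) (gcomp med c)) (mmap P (gbang X)).
    by move=> p a; exact: (m1 p (c p a)).
  have E2 : geq (gcomp (ar P X) (gcomp med c)) (ar P X).
    by move=> p a; exact: (m2 p (c p a)).
  have /= -> := uniq _ E1 E2 m z.
  by have /= <- := uniq (gid (P X)) (fun _ _ => erefl) (fun _ _ => erefl) m z.
rewrite -(cK _ x) -(cK _ y); congr (med n _).
by apply: (@cells_eq _); rewrite /= e1 e2.
Qed.

Section MkCell.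
Variables (X : gset) (n : nat) (phi : P gone n) (u : F X n) (k : F gone n).
Hypotheses (hphi : ar P gone n phi = k) (hu : shape_of u = k).

Lemma mkcell_instr : mmap P (gbang X) n (mkcell hphi hu) = phi.
Proof. by rewrite /mkcell; case: cid => z []. Qed.

Lemma mkcell_ar : ar P X n (mkcell hphi hu) = u.
Proof. by rewrite /mkcell; case: cid => z []. Qed.

End MkCell.

Lemma shape_ar (X : gset) n (z : P X n) :
  shape_of (ar P X n z) = ar P gone n (mmap P (gbang X) n z).
Proof. exact: (esym (mm_nat (ar P) (gbang X) z)). Qed.

(** * Weak operations as evaluations of strict expressions *)

Lemma sp_feta n : sp P (feta F gone n tt) = meta P gone n tt.
Proof.
case: n => [|n] //; rewrite /sp /=; by case: pselect.
Qed.

(** Makes [sp] globular, so that [spcell] below is a globular map. *)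
Lemma src_tgt_sp n (k : F gone n.+1) :
  src (sp P k) = sp P (src k) /\ tgt (sp P k) = sp P (tgt k).
Proof.
have [ek|nk] := pselect (k = feta F gone n.+1 tt).
  by rewrite ek -!gmap_src -!gmap_tgt !sp_feta -gmap_src -gmap_tgt.
(* Every cell of T1 is a loop, so both boundaries of [sp P k] are the same instruction chosen for
   [src k]. *)
rewrite -(proj1 (loopP k)) {1 3}/sp /=; case: pselect => // _.
by rewrite /sp; case: sp_sig => p e /=; rewrite src_kappa tgt_kappa.
Qed.

(** A section of [ar P X], built as a globular map so that boundaries of weak operations can be
    taken inside the strict expression. *)
Definition spcell (X : gset) : gmap (F X) (P X).
Proof.
refine (@GMap (F X) (P X) (fun n u => mkcell (ar_sp P (shape_of u)) erefl) _ _).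
- move=> n u; apply: cell_ext; rewrite gmap_src ?mkcell_instr ?mkcell_ar //.
  by rewrite (proj1 (src_tgt_sp _)) /shape_of gmap_src.
- move=> n u; apply: cell_ext; rewrite gmap_tgt ?mkcell_instr ?mkcell_ar //.
  by rewrite (proj2 (src_tgt_sp _)) /shape_of gmap_tgt.
Defined.

Lemma spcell_instr (X : gset) n (u : F X n) :
  mmap P (gbang X) n (spcell X n u) = sp P (shape_of u).
Proof. exact: mkcell_instr. Qed.

Lemma spcell_ar (X : gset) n (u : F X n) : ar P X n (spcell X n u) = u.
Proof. exact: mkcell_ar. Qed.

Lemma spcell_feta (X : gset) n (x : X n) :
  spcell X n (feta F X n x) = meta P X n x.
Proof.
apply: cell_ext; rewrite ?spcell_instr ?spcell_ar.
  by rewrite shape_feta sp_feta; have /= -> := meta_nat P (gbang X) x.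
by have /= -> := mm_eta (ar P) x.
Qed.

Lemma mmap_bang (X Y : gset) (f : gmap X Y) n (z : P X n) :
  mmap P (gbang Y) n (mmap P f n z) = mmap P (gbang X) n z.
Proof.
have -> : gbang X = gcomp (gbang Y) f by exact: gmap_ext.
by rewrite (mmap_comp (gbang Y) f z).
Qed.

(** The instruction depends only on the shape, which [fmap] does not change. *)
Lemma spcell_nat (X Y : gset) (f : gmap X Y) n (u : F X n) :
  mmap P f n (spcell X n u) = spcell Y n (fmap F f n u).
Proof.
apply: cell_ext; rewrite ?mmap_bang ?spcell_instr ?shape_gmap //.
rewrite spcell_ar -[in RHS](spcell_ar u).
exact: (mm_nat (ar P) f (spcell X n u)).
Qed.

Definition spact (A : algebra P) : gmap (F A) A := gcomp (astr A) (spcell A).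

Lemma spactE (A : algebra P) n (u : F A n) :
  spact A n u = astr A n (spcell A n u).
Proof. by []. Qed.

Lemma spact_feta (A : algebra P) n (x : A n) : spact A n (feta F A n x) = x.
Proof. by rewrite spactE spcell_feta; exact: (astr_eta x). Qed.

Lemma wcompE (A : algebra P) k m1 m2 n (e : maxn m1 m2 = n)
    (h1 : k < m1) (h2 : k < m2) (x : A m1) (y : A m2) :
  wcomp e h1 h2 x y = spact A n (mcomp e h1 h2 (feta F A m1 x) (feta F A m2 y)).
Proof. by []. Qed.

Lemma widE (A : algebra P) n (x : A n) :
  wid x = spact A n.+1 (oid (feta F A n x)).
Proof. by []. Qed.

(** * Boundaries of weak identities, composites and whiskerings *)

Section Boundaries.
Variable A : algebra P.

Lemma feta_composable k m1 m2 (h1 : k <= m1) (h2 : k <= m2) (x : A m1)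
    (y : A m2) :
  tgts h1 x = srcs h2 y ->
  tgts h1 (feta F A m1 x) = srcs h2 (feta F A m2 y).
Proof. by move=> xy; rewrite -gmap_tgts -gmap_srcs xy. Qed.

Lemma src_wid n (x : A n) : src (wid x) = x.
Proof. by rewrite widE -gmap_src src_oid spact_feta. Qed.

Lemma tgt_wid n (x : A n) : tgt (wid x) = x.
Proof. by rewrite widE -gmap_tgt tgt_oid spact_feta. Qed.

Section Composable.
Variables (k m1 m2 n : nat) (e : maxn m1 m2 = n) (h1 : k < m1) (h2 : k < m2).
Variables (x : A m1) (y : A m2).
Hypothesis xy : tgts (ltnW h1) x = srcs (ltnW h2) y.

Lemma srcs_wcomp (h : k <= n) : srcs h (wcomp e h1 h2 x y) = srcs (ltnW h1) x.
Proof.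
rewrite wcompE -gmap_srcs (srcs_mcomp e (feta_composable xy)).
by rewrite -gmap_srcs spact_feta.
Qed.

Lemma tgts_wcomp (h : k <= n) : tgts h (wcomp e h1 h2 x y) = tgts (ltnW h2) y.
Proof.
rewrite wcompE -gmap_tgts (tgts_mcomp e (feta_composable xy)).
by rewrite -gmap_tgts spact_feta.
Qed.

End Composable.

Definition whiskerable (X : gset) j m (h : j < m) (l : X j.+1) (x : X m)
    (r : X j.+1) : Prop :=
  tgt l = srcs (ltnW h) x /\ src r = tgts (ltnW h) x.

Lemma whiskerable_composable j m (h : j < m) (l : A j.+1) (x : A m)
    (r : A j.+1) :
  whiskerable h l x r ->
  tgts (ltnW h) x = srcs (ltnW (ltnSn j)) r /\
  tgts (ltnW (ltnSn j)) l =
    srcs (ltnW h) (wcomp (maxn_ltr h) h (ltnSn j) x r).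
Proof.
move=> [lx xr]; have c : tgts (ltnW h) x = srcs (ltnW (ltnSn j)) r.
  by rewrite srcs_top xr.
by rewrite (srcs_wcomp (maxn_ltr h) c) tgts_top.
Qed.

Lemma srcs_whisker j m (h : j < m) (l : A j.+1) (x : A m) (r : A j.+1) :
  whiskerable h l x r -> srcs (ltnW h) (whisker h l x r) = src l.
Proof.
by move=> /whiskerable_composable[_ c]; rewrite (srcs_wcomp _ c) srcs_top.
Qed.

Lemma tgts_whisker j m (h : j < m) (l : A j.+1) (x : A m) (r : A j.+1) :
  whiskerable h l x r -> tgts (ltnW h) (whisker h l x r) = tgt r.
Proof.
move=> /whiskerable_composable[c c'].
by rewrite (tgts_wcomp _ c') (tgts_wcomp _ c) tgts_top.
Qed.

Lemma src_whisker j m (h : j < m) (h' : j < m.+1) (l : A j.+1) (x : A m.+1)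
    (r : A j.+1) :
  whiskerable h' l x r -> src (whisker h' l x r) = whisker h l (src x) r.
Proof.
move=> w; have [c c'] := whiskerable_composable w; case: w => lx xr.
rewrite /whisker wcompE -gmap_src (src_mcompl h); last first.
  by have := feta_composable c'; rewrite tgts_top.
rewrite -gmap_src wcompE -gmap_src (src_mcompr h).
  by rewrite -gmap_src.
by have := feta_composable c; rewrite srcs_top.
Qed.

Lemma tgt_whisker j m (h : j < m) (h' : j < m.+1) (l : A j.+1) (x : A m.+1)
    (r : A j.+1) :
  whiskerable h' l x r -> tgt (whisker h' l x r) = whisker h l (tgt x) r.
Proof.
move=> w; have [c c'] := whiskerable_composable w; case: w => lx xr.
rewrite /whisker wcompE -gmap_tgt (tgt_mcompl h); last first.
  by have := feta_composable c'; rewrite tgts_top.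
rewrite -gmap_tgt wcompE -gmap_tgt (tgt_mcompr h).
  by rewrite -gmap_tgt.
by have := feta_composable c; rewrite srcs_top.
Qed.

End Boundaries.

(** * Maps that preserve the weak operations *)

Section Morphisms.
Variables (A B : algebra P) (f : gmap A B).
Hypothesis f_astr : geq (gcomp f (astr A)) (gcomp (astr B) (mmap P f)).

Lemma spact_nat n (u : F A n) : f n (spact A n u) = spact B n (fmap F f n u).
Proof. by rewrite !spactE -spcell_nat; exact: (f_astr (spcell A n u)). Qed.

Lemma morph_wid n (x : A n) : f n.+1 (wid x) = wid (f n x).
Proof. by rewrite !widE spact_nat ofun_id fmapE. Qed.

Lemma morph_wcomp k m1 m2 n (e : maxn m1 m2 = n) (h1 : k < m1) (h2 : k < m2)
    (x : A m1) (y : A m2) :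
  tgts (ltnW h1) x = srcs (ltnW h2) y ->
  f n (wcomp e h1 h2 x y) = wcomp e h1 h2 (f m1 x) (f m2 y).
Proof.
move=> xy; rewrite !wcompE spact_nat ofun_mcomp ?fmapE //.
exact: feta_composable.
Qed.

Lemma morph_whisker j m (h : j < m) (l : A j.+1) (x : A m) (r : A j.+1) :
  whiskerable h l x r ->
  f m (whisker h l x r) = whisker h (f j.+1 l) (f m x) (f j.+1 r).
Proof.
by move=> /whiskerable_composable[c c']; rewrite /whisker !morph_wcomp.
Qed.

End Morphisms.

Section FreeAlgebra.
Variable X : gset.
Let A := free_algebra P X.

(** [ar] is a monad map and [spcell] a section of it, so evaluation in [P X] lies over substitution
    of diagrams. The weak operations of [P X] thus lie over the strict ones of [F X]. *)
Lemma ar_spact n (u : F A n) :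
  ar P X n (spact A n u) = fmu F X n (fmap F (ar P X) n u).
Proof.
rewrite -[in RHS](spcell_ar u); exact: (mm_mu (ar P) (spcell A n u)).
Qed.

Lemma ar_wid n (x : A n) : ar P X n.+1 (wid x) = oid (ar P X n x).
Proof. by rewrite widE ar_spact !ofun_id fmapE fmuE. Qed.

Lemma ar_wcomp k m1 m2 n (e : maxn m1 m2 = n) (h1 : k < m1) (h2 : k < m2)
    (x : A m1) (y : A m2) :
  tgts (ltnW h1) x = srcs (ltnW h2) y ->
  ar P X n (wcomp e h1 h2 x y) = mcomp e h1 h2 (ar P X m1 x) (ar P X m2 y).
Proof.
move=> xy; have xy' := feta_composable xy.
rewrite wcompE ar_spact (ofun_mcomp (fmap F (ar P X)) e xy') !fmapE.
rewrite (ofun_mcomp (fmu F X)) ?fmuE //.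
by rewrite -!gmap_tgts -!gmap_srcs xy.
Qed.

(** The diagram survives because its whiskers are identities on its own boundaries: the strict unit
    laws apply. *)
Lemma ar_whisker j m (h : j < m) (l : A j.+1) (x : A m) (r : A j.+1)
    (u : F X m) :
  whiskerable h l x r -> ar P X m x = u ->
  ar P X j.+1 l = oid (srcs (ltnW h) u) ->
  ar P X j.+1 r = oid (tgts (ltnW h) u) ->
  ar P X m (whisker h l x r) = u.
Proof.
move=> /whiskerable_composable[c c'] xu lu ru.
by rewrite /whisker !ar_wcomp // xu lu ru mcomp_oidr mcomp_oidl.
Qed.

End FreeAlgebra.

(** For [f = gbang X], this says that reading off instructions preserves the weak operations;
    [astr_morph] says the same for evaluation. *)
Lemma free_morph (X Y : gset) (f : gmap X Y) :
  geq (gcomp (mmap P f) (astr (free_algebra P X)))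
      (gcomp (astr (free_algebra P Y)) (mmap P (mmap P f))).
Proof. exact: mmu_nat. Qed.

Lemma astr_morph (A : algebra P) :
  geq (gcomp (astr A) (astr (free_algebra P A)))
      (gcomp (astr A) (mmap P (astr A))).
Proof. exact: astr_mu. Qed.

(** * Contraction in [P X] and invertibility *)

Lemma parallel_gmap (X Y : gset) (f : gmap X Y) n (x y : X n) :
  parallel x y -> parallel (f n x) (f n y).
Proof.
by case: n x y => // n x y /= [s t]; rewrite -!gmap_src -!gmap_tgt s t.
Qed.

(** The contraction of [P gone], applied to the instructions over the identity of the shape of [u],
    is paired with the diagram [oid u]. *)
Lemma contract (X : gset) n (x y : P X n) (u : F X n) :
  parallel x y -> ar P X n x = u -> ar P X n y = u ->
  exists z : P X n.+1, [/\ src z = x, tgt z = y & ar P X n.+1 z = oid u].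
Proof.
move=> xy xu yu; pose k := oid (shape_of u).
have sk : src k = ar P gone n (mmap P (gbang X) n x).
  by rewrite src_oid -xu shape_ar.
have tk : tgt k = ar P gone n (mmap P (gbang X) n y).
  by rewrite tgt_oid -yu shape_ar.
have hu : shape_of (oid u) = k by rewrite /shape_of ofun_id.
exists (mkcell (ar_kappa (parallel_gmap (mmap P (gbang X)) xy) sk tk) hu).
split; last exact: mkcell_ar.
- apply: cell_ext; rewrite gmap_src ?mkcell_instr ?mkcell_ar ?src_kappa //.
  by rewrite src_oid.
- apply: cell_ext; rewrite gmap_tgt ?mkcell_instr ?mkcell_ar ?tgt_kappa //.
  by rewrite tgt_oid.
Qed.

(** Keeps the corecursive calls directly under [Invertible], so that an application only has to
    exhibit a class [R] with the closure property. *)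
Lemma invertible_coind (A : algebra P) (R : forall n, A n.+1 -> Prop) :
  (forall n (u : A n.+1), R n u -> exists (v : A n.+1) (p q : A n.+2),
    [/\ src v = tgt u /\ tgt v = src u,
        src p = wcomp (maxnn n.+1) (ltnSn n) (ltnSn n) u v /\
          tgt p = wid (src u),
        src q = wcomp (maxnn n.+1) (ltnSn n) (ltnSn n) v u /\
          tgt q = wid (tgt u)
      & R n.+1 p /\ R n.+1 q]) ->
  forall n (u : A n.+1), R n u -> invertible u.
Proof.
move=> step; cofix inv => n u /step [v [p [q [[s t] [sp tp] [sq tq] [Rp Rq]]]]].
exact: (@Invertible F P A n u v s t p sp tp (inv _ _ Rp)
  q sq tq (inv _ _ Rq)).
Qed.

Lemma invertible_astr (A : algebra P) : forall n (z : P A n.+1) (u : F A n),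
  ar P A n.+1 z = oid u -> invertible (astr A n.+1 z).
Proof.
move=> n z u zu; pose R m (x : A m.+1) :=
  exists (y : P A m.+1) (v : F A m), ar P A m.+1 y = oid v /\ x = astr A m.+1 y.
apply: (@invertible_coind A R); last by exists z, u.
move=> {zu u z n} n _ [z [u [zu ->]]].
have xi_comp := morph_wcomp (@astr_morph A).
have xi_id := morph_wid (@astr_morph A).
have su : ar P A n (src z) = u by rewrite gmap_src zu src_oid.
have tu : ar P A n (tgt z) = u by rewrite gmap_tgt zu tgt_oid.
have ts : parallel (tgt z) (src z).
  by case: (n) z {zu su tu} => // m z /=; rewrite src_src tgt_src.
(* Both ends of [z] lie over [u], so the contraction also gives a cell in the opposite direction. *)
have [z' [sz' tz' zu']] := contract ts tu su.
have c : tgts (ltnW (ltnSn n)) z = srcs (ltnW (ltnSn n)) z'.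
  by rewrite tgts_top srcs_top.
have c' : tgts (ltnW (ltnSn n)) z' = srcs (ltnW (ltnSn n)) z.
  by rewrite tgts_top srcs_top.
pose zz' := wcomp (A := free_algebra P A) (maxnn n.+1) (ltnSn n) (ltnSn n) z z'.
pose z'z := wcomp (A := free_algebra P A) (maxnn n.+1) (ltnSn n) (ltnSn n) z' z.
have pzz' : parallel zz' (wid (A := free_algebra P A) (src z)).
  rewrite /= (src_wid (A := free_algebra P A)).
  rewrite (tgt_wid (A := free_algebra P A)).
  rewrite -(srcs_top (leqnSn n) zz') -(tgts_top (leqnSn n) zz').
  rewrite (srcs_wcomp (A := free_algebra P A) _ c).
  by rewrite (tgts_wcomp (A := free_algebra P A) _ c) srcs_top tgts_top.
have pz'z : parallel z'z (wid (A := free_algebra P A) (tgt z)).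
  rewrite /= (src_wid (A := free_algebra P A)).
  rewrite (tgt_wid (A := free_algebra P A)).
  rewrite -(srcs_top (leqnSn n) z'z) -(tgts_top (leqnSn n) z'z).
  rewrite (srcs_wcomp (A := free_algebra P A) _ c').
  by rewrite (tgts_wcomp (A := free_algebra P A) _ c') srcs_top tgts_top.
(* The composite and the weak identity both lie over [oid u], so the cancellation cell can be taken
   over [oid (oid u)], which keeps its evaluation in [R]. *)
have [||p [sp tp pu]] := contract (u := oid u) pzz'.
- by rewrite (ar_wcomp _ c) zu zu' mcomp_oid.
- by rewrite ar_wid su.
have [||q [sq tq qu]] := contract (u := oid u) pz'z.
- by rewrite (ar_wcomp _ c') zu zu' mcomp_oid.
- by rewrite ar_wid tu.
exists (astr A n.+1 z'), (astr A n.+2 p), (astr A n.+2 q); split.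
- by rewrite -!gmap_src -!gmap_tgt sz' tz'.
- by rewrite -!gmap_src -!gmap_tgt sp tp xi_id; split=> //; exact: xi_comp.
- by rewrite -!gmap_src -!gmap_tgt sq tq xi_id; split=> //; exact: xi_comp.
- by split; [exists p, (oid u) | exists q, (oid u)].
Qed.

(** * Boundaries of the padding instructions *)

Section Padding.
Variables (n : nat) (phi chi : P gone n) (k : F gone n).
Hypotheses (ar_phi : ar P gone n phi = k) (ar_chi : ar P gone n chi = k).

(** Only agreement one dimension below [j] is needed; quantifying over [i.+1 = j] makes the
    condition vacuous at [j = 0]. *)
Lemma parallel_srcs (X : gset) j (h : j <= n) (x y : X n) :
  (forall i (h' : i <= n), i.+1 = j ->
     srcs h' x = srcs h' y /\ tgts h' x = tgts h' y) ->
  parallel (srcs h x) (srcs h y).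
Proof.
case: j h => // j h b; have [s t] := b j (ltnW h) erefl.
by rewrite /= !(src_srcs h (ltnW h)) !(tgt_srcs h (ltnW h)).
Qed.

Lemma parallel_tgts (X : gset) j (h : j <= n) (x y : X n) :
  (forall i (h' : i <= n), i.+1 = j ->
     srcs h' x = srcs h' y /\ tgts h' x = tgts h' y) ->
  parallel (tgts h x) (tgts h y).
Proof.
case: j h => // j h b; have [s t] := b j (ltnW h) erefl.
by rewrite /= !(src_tgts h (ltnW h)) !(tgt_tgts h (ltnW h)).
Qed.

Section Step.
Variables (j : nat) (h : j <= n) (p : P gone n).
Hypotheses (ar_p : ar P gone n p = k)
  (bnd_p : forall i (h' : i <= n), i.+1 = j ->
     srcs h' p = srcs h' chi /\ tgts h' p = tgts h' chi).

Lemma lam_boundary :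
  src (lam_of chi k h p) = srcs h chi /\ tgt (lam_of chi k h p) = srcs h p.
Proof.
(* The default branch is excluded by proving the three conditions for [kappa]. *)
rewrite /lam_of /kappa_tot; case: pselect => [[q e e']|[]].
  by rewrite src_kappa tgt_kappa.
split.
- by apply: parallel_srcs => i h' ij; have [-> ->] := bnd_p h' ij.
- by rewrite src_oid gmap_srcs ar_chi.
- by rewrite tgt_oid gmap_srcs ar_p.
Qed.

Lemma rho_boundary :
  src (rho_of chi k h p) = tgts h p /\ tgt (rho_of chi k h p) = tgts h chi.
Proof.
rewrite /rho_of /kappa_tot; case: pselect => [[q e e']|[]].
  by rewrite src_kappa tgt_kappa.
split.
- exact: parallel_tgts.
- by rewrite src_oid gmap_tgts ar_p.
- by rewrite tgt_oid gmap_tgts ar_chi.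
Qed.

End Step.

(** The invariant that makes padding well defined. Whiskers over identities preserve the arity, and
    their outer ends replace the boundary one dimension below [i] by that of [chi]. *)
Lemma pad_phi_spec i (h : i <= n) :
  ar P gone n (pad_phi phi chi k h) = k /\
  forall j (h' : j <= n), j.+1 = i ->
    srcs h' (pad_phi phi chi k h) = srcs h' chi /\
    tgts h' (pad_phi phi chi k h) = tgts h' chi.
Proof.
elim: i h => [|i IH] h //=.
have [ar_p bnd_p] := IH (ltnW h); move: (pad_phi _ _ _ _) ar_p bnd_p => p.
move=> ar_p bnd_p.
have [sl tl] := lam_boundary (ltnW h) ar_p bnd_p.
have [sr tr] := rho_boundary (ltnW h) ar_p bnd_p.
have wh : whiskerable h (lam_of chi k (ltnW h) p) p (rho_of chi k (ltnW h) p).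
  by rewrite /whiskerable tl sr.
split; first by apply: (ar_whisker wh) => //; exact: ar_kappa_tot.
move=> j h' [ij]; subst j; rewrite !(Prop_irrelevance h' (ltnW h)).
rewrite (srcs_whisker (A := free_algebra P gone) wh).
by rewrite (tgts_whisker (A := free_algebra P gone) wh).
Qed.

Lemma pad_lam_boundary j (h : j <= n) :
  src (pad_lam phi chi k h) = srcs h chi /\
  tgt (pad_lam phi chi k h) = srcs h (pad_phi phi chi k h).
Proof. by have [] := pad_phi_spec h; exact: lam_boundary. Qed.

Lemma pad_rho_boundary j (h : j <= n) :
  src (pad_rho phi chi k h) = tgts h (pad_phi phi chi k h) /\
  tgt (pad_rho phi chi k h) = tgts h chi.
Proof. by have [] := pad_phi_spec h; exact: rho_boundary. Qed.

(** * Lifting the padding from [A] to the free algebra [P A] *)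

Variables (A : algebra P) (u v : F A n).
Hypotheses (hu : shape_of u = k) (hv : shape_of v = k).
(** Here [phidot] is a cell of [P A]: it stands for the pair of an instruction and [W]. *)
Variables (w : A n.+1) (W : F A n.+1) (phidot : P A n.+1).
Hypotheses (src_W : src W = u) (tgt_W : tgt W = v).
Hypotheses (ar_phidot : ar P A n.+1 phidot = W)
  (src_phidot : mmap P (gbang A) n (src phidot) = phi)
  (tgt_phidot : mmap P (gbang A) n (tgt phidot) = phi)
  (w_eq : w = astr A n.+1 phidot).

Let instr := mmap P (gbang A).
Let FA := free_algebra P A.

Section LiftStep.
Variables (j : nat) (hj : j < n.+1) (z : FA n.+1).
Hypotheses (ar_z : ar P A n.+1 z = W)
  (src_z : instr n (src z) = pad_phi phi chi k (hj : j <= n))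
  (tgt_z : instr n (tgt z) = pad_phi phi chi k (hj : j <= n)).

Let l : FA j.+1 :=
  mkcell (ar_pad_lam phi chi k (hj : j <= n)) (shape_id_srcs (hj : j <= n) hu).
Let r : FA j.+1 :=
  mkcell (ar_pad_rho phi chi k (hj : j <= n)) (shape_id_tgts (hj : j <= n) hv).

(** Checked on components: instructions match by the boundaries of the padding instructions,
    diagrams because [W] goes from [u] to [v]. *)
Lemma lift_whiskerable : whiskerable hj l z r.
Proof.
have [_ tl] := pad_lam_boundary (hj : j <= n).
have [sr _] := pad_rho_boundary (hj : j <= n).
split; apply: cell_ext.
- rewrite gmap_tgt mkcell_instr tl gmap_srcs (srcs_src _ (hj : j <= n)).
  by rewrite -gmap_src -src_z.
- rewrite gmap_tgt mkcell_ar tgt_oid gmap_srcs ar_z.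
  by rewrite (srcs_src _ (hj : j <= n)) src_W.
- rewrite gmap_src mkcell_instr sr gmap_tgts (tgts_tgt _ (hj : j <= n)).
  by rewrite -gmap_tgt -tgt_z.
- rewrite gmap_src mkcell_ar src_oid gmap_tgts ar_z.
  by rewrite (tgts_tgt _ (hj : j <= n)) tgt_W.
Qed.

Lemma instr_whiskerable :
  whiskerable hj (pad_lam phi chi k (hj : j <= n)) (instr n.+1 z)
    (pad_rho phi chi k (hj : j <= n)).
Proof.
have [lz zr] := lift_whiskerable; split.
  by rewrite -[pad_lam _ _ _ _](mkcell_instr (ar_pad_lam phi chi k (hj : j <= n))
    (shape_id_srcs (hj : j <= n) hu)) -gmap_tgt lz gmap_srcs.
by rewrite -[pad_rho _ _ _ _](mkcell_instr (ar_pad_rho phi chi k (hj : j <= n))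
    (shape_id_tgts (hj : j <= n) hv)) -gmap_src zr gmap_tgts.
Qed.

Lemma instr_lift :
  instr n.+1 (whisker hj l z r) =
  whisker (A := free_algebra P gone) hj (pad_lam phi chi k (hj : j <= n))
    (instr n.+1 z) (pad_rho phi chi k (hj : j <= n)).
Proof.
rewrite (morph_whisker (A := FA) (B := free_algebra P gone)
  (@free_morph A gone (gbang A)) lift_whiskerable).
by rewrite !mkcell_instr.
Qed.

Lemma ar_lift : ar P A n.+1 (whisker hj l z r) = W.
Proof.
apply: (ar_whisker lift_whiskerable ar_z); rewrite mkcell_ar.
  by rewrite (srcs_src _ (hj : j <= n)) src_W.
by rewrite (tgts_tgt _ (hj : j <= n)) tgt_W.
Qed.

Lemma astr_lift :
  astr A n.+1 (whisker hj l z r) =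
  whisker hj (pad_l phi chi hu (hj : j <= n)) (astr A n.+1 z)
    (pad_r phi chi hv (hj : j <= n)).
Proof. exact: (morph_whisker (A := FA) (@astr_morph A) lift_whiskerable). Qed.

End LiftStep.

(** Stops at [i <= n], where the boundary instruction is still some [pad_phi]; the last whiskering
    acts on the boundary differently. *)
Lemma pad_iter_lift i (h : i <= n.+1) (hi : i <= n) : exists z : FA n.+1,
  [/\ astr A n.+1 z = pad_iter phi chi hu hv w h, ar P A n.+1 z = W,
      instr n (src z) = pad_phi phi chi k hi
    & instr n (tgt z) = pad_phi phi chi k hi].
Proof.
elim: i h hi => [|j IH] h hi; first by exists phidot.
have [z [xz az sz tz]] := IH (ltnW h) (ltnW hi).
have sz' : instr n (src z) = pad_phi phi chi k (h : j <= n).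
  by rewrite sz; congr pad_phi; exact: Prop_irrelevance.
have tz' : instr n (tgt z) = pad_phi phi chi k (h : j <= n).
  by rewrite tz; congr pad_phi; exact: Prop_irrelevance.
have wh := instr_whiskerable az sz' tz'.
eexists; split.
- by rewrite /= -xz; exact: (astr_lift az sz' tz').
- exact: (ar_lift az sz' tz').
- rewrite gmap_src (instr_lift az sz' tz').
  rewrite (src_whisker (A := free_algebra P gone) hi wh) -gmap_src sz'.
  by rewrite /= (Prop_irrelevance (ltnW hi) (h : j <= n)).
- rewrite gmap_tgt (instr_lift az sz' tz').
  rewrite (tgt_whisker (A := free_algebra P gone) hi wh) -gmap_tgt tz'.
  by rewrite /= (Prop_irrelevance (ltnW hi) (h : j <= n)).
Qed.

(** The last whiskering is along dimension n, so it does not whisker the boundary but replaces it by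
    the outer ends of lambda_(n+1) and rho_(n+1), which are [chi]. *)
Lemma padding_lift : exists z : FA n.+1,
  [/\ astr A n.+1 z = padding phi chi u v hu hv w, ar P A n.+1 z = W,
      instr n (src z) = chi & instr n (tgt z) = chi].
Proof.
pose h := leqnn n.+1.
have [z [xz az sz tz]] := pad_iter_lift (ltnW h) (h : n <= n).
have wh := instr_whiskerable az sz tz.
have [sl _] := pad_lam_boundary (h : n <= n).
have [_ tr] := pad_rho_boundary (h : n <= n).
eexists; split.
- by rewrite /padding /= -xz; exact: (astr_lift az sz tz).
- exact: (ar_lift az sz tz).
- rewrite gmap_src (instr_lift az sz tz) -(srcs_top (ltnW h)).
  by rewrite (srcs_whisker (A := free_algebra P gone) wh) sl srcs_id.
- rewrite gmap_tgt (instr_lift az sz tz) -(tgts_top (ltnW h)).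
  by rewrite (tgts_whisker (A := free_algebra P gone) wh) tr tgts_id.
Qed.

End Padding.

End Contracted.

Theorem lemma3p2p10 (F : free_omega) (L : contracted F)
  (initL : initial_contracted L)
  (n : nat) (n_ge1 : 1 <= n)
  (phi chi : L gone n) (k : F gone n)
  (ar_phi : ar L gone n phi = k) (ar_chi : ar L gone n chi = k)
  (X : algebra L)
  (u v : F X n) (uv : parallel u v)
  (shape_u : shape_of u = k) (shape_v : shape_of v = k)
  (w : X n.+1)
  (src_w : src w = act phi u ar_phi shape_u) (tgt_w : tgt w = act phi v ar_phi shape_v)
  (kdot : F gone n.+1) (src_kdot : src kdot = k) (tgt_kdot : tgt kdot = k)
  (phidot chidot : L gone n.+1)
  (src_phidot : src phidot = phi) (tgt_phidot : tgt phidot = phi)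
  (src_chidot : src chidot = chi) (tgt_chidot : tgt chidot = chi)
  (ar_phidot : ar L gone n.+1 phidot = kdot)
  (ar_chidot : ar L gone n.+1 chidot = kdot)
  (W : F X n.+1) (src_W : src W = u) (tgt_W : tgt W = v)
  (shape_W : shape_of W = kdot)
  (w_eq : w = act phidot W ar_phidot shape_W) :
  exists c : X n.+2,
    [/\ src c = padding phi chi u v shape_u shape_v w,
        tgt c = act chidot W ar_chidot shape_W
      & invertible c].
Proof.
have [||z [<- ar_z src_z tgt_z]] := padding_lift ar_phi ar_chi shape_u shape_v
  src_W tgt_W (mkcell_ar ar_phidot shape_W) _ _ w_eq.
- by rewrite gmap_src mkcell_instr.
- by rewrite gmap_tgt mkcell_instr.
pose y := mkcell ar_chidot shape_W.
(* Compared by components: both cells have [chi] as instruction at either end and the diagram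
   [W]. *)
have zy : parallel z y.
  split; apply: cell_ext.
  - by rewrite src_z gmap_src mkcell_instr.
  - by rewrite !gmap_src ar_z mkcell_ar.
  - by rewrite tgt_z gmap_tgt mkcell_instr.
  - by rewrite !gmap_tgt ar_z mkcell_ar.
have [c [src_c tgt_c ar_c]] := contract zy ar_z (mkcell_ar _ _).
exists (astr X n.+2 c); split; last exact: invertible_astr ar_c.
- by rewrite -gmap_src src_c.
- by rewrite -gmap_tgt tgt_c.
Qed.
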